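(* Let $\phi:(M,g,J)\to(N,h,J^N)$ be a surjective horizontally weakly conformal holomorphic map between almost Hermitian manifolds. Then any two of the following conditions imply the third: (i) $\phi$ is harmonic (and so a harmonic morphism); (ii) $d\phi(J\delta J)=0$; (iii) $N$ is cosymplectic.
   Context: An almost Hermitian manifold $(M^m,g,J)$ is a Riemannian manifold $(M,g)$ of real dimension $2m$ with an almost complex structure $J:TM\to TM$, $J^2=-I$, which is isometric on each tangent space (not assumed integrable). $\nabla$ denotes the Levi-Civita connection. The divergence of $J$ is the vector field $\delta J=\sum_{k=1}^m\{(\nabla_{e_k}J)(e_k)+(\nabla_{Je_k}J)(Je_k)\}$, where $\{e_1,\dots,e_m,Je_1,\dots,Je_m\}$ is any local orthonormal frame. An almost Hermitian manifold is cosymplectic (semi-Kähler) if the divergence of its almost complex structure vanishes. A smooth map $\phi:M\to N$ between almost Hermitian manifolds is holomorphic if $d\phi\circ J=J^N\circ d\phi$. The tension field of $\phi$ is the trace of its second fundamental form, $\tau(\phi)=\sum_j\{\nabla^{\phi^{-1}TN}_{e_j}d\phi(e_j)-d\phi(\nabla_{e_j}e_j)\}$ over a local orthonormal frame $\{e_j\}$ of $TM$; $\phi$ is harmonic if $\tau(\phi)=0$. A smooth map $\phi:(M,g)\to(N,h)$ is horizontally weakly conformal if for each $x\in M$ either $d\phi_x=0$ ($x$ is a critical point) or, with $\mathcal V_x=\ker d\phi_x$ and $\mathcal H_x=\mathcal V_x^\perp$, the restriction $d\phi_x|_{\mathcal H_x}$ is a conformal linear map onto $T_{\phi(x)}N$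 ($x$ is a regular point). A harmonic morphism is a smooth map pulling back germs of real-valued harmonic functions on $N$ to germs of harmonic functions on $M$; by a theorem of Fuglede and Ishihara a smooth map is a harmonic morphism if and only if it is harmonic and horizontally weakly conformal. *)

(* Defs.v *)
From HB Require Import structures.
From mathcomp Require Import all_boot all_order all_algebra.
From mathcomp Require Import all_classical all_reals all_analysis.
From mathcomp Require Import ring.
Set Implicit Arguments.
Unset Strict Implicit.
Unset Printing Implicit Defensive.
Import Order.TTheory GRing.Theory Num.Theory.
Import numFieldNormedType.Exports.
Local Open Scope classical_set_scope.
Local Open Scope ring_scope.

(* Conventions.  The components of a tangent vector in a chart form a row
   vector, and linear maps act on it by multiplication on the right: the
   differential of f at x is v |-> v *m 'J f x.  A tensor field on a manifold
   is a family, indexed by the charts of the atlas, of functions of the chart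
   coordinates, obeying the tensor transformation law on chart overlaps.  The
   values of these functions outside the image of the chart are irrelevant. *)

Section Smooth.
Context {R : realType} {n : nat} {W : normedModType R}.
Implicit Types (U : set 'rV[R]_n) (f : 'rV[R]_n -> W).

Fixpoint Ck (k : nat) U f : Prop :=
  match k with
  | 0 => forall x, U x -> {for x, continuous f}
  | k'.+1 => (forall x, U x -> differentiable f x) /\
             (forall v : 'rV[R]_n, Ck k' U (fun x => 'D_v f x))
  end.

Definition smooth_on U f : Prop := forall k, Ck k U f.

End Smooth.

Record chart (R : realType) (n : nat) (T : topologicalType) := Chart {
  dom : set T;
  img : set 'rV[R]_n;
  coord : T -> 'rV[R]_n;
  param : 'rV[R]_n -> T;
  dom_open : open dom;
  img_open : open img;
  coord_img : forall p, dom p -> img (coord p);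
  param_dom : forall x, img x -> dom (param x);
  coordK : forall p, dom p -> param (coord p) = p;
  paramK : forall x, img x -> coord (param x) = x;
  coord_continuous : forall p, dom p -> {for p, continuous coord};
  param_continuous : forall x, img x -> {for x, continuous param}
}.

Section LocalExpression.
Context {R : realType} {n n' : nat} {T T' : topologicalType}.

Definition local_dom (c : chart R n T) (c' : chart R n' T') (f : T -> T') :
  set 'rV[R]_n := [set x | img c x /\ dom c' (f (param c x))].

Definition local_expr (c : chart R n T) (c' : chart R n' T') (f : T -> T') :
  'rV[R]_n -> 'rV[R]_n' := fun x => coord c' (f (param c x)).

End LocalExpression.

Record manifold (R : realType) (n : nat) := Manifold {
  points :> topologicalType;
  points_hausdorff : hausdorff_space points;
  points_second_countable : @second_countable points;
  atlas : Type;
  chart_of : atlas -> chart R n points;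
  atlas_cover : forall p : points, exists i, dom (chart_of i) p;
  atlas_compatible : forall i j,
    smooth_on (local_dom (chart_of i) (chart_of j) id)
              (local_expr (chart_of i) (chart_of j) id)
}.

Definition form {R : realType} {n : nat} (A : 'M[R]_n) (u v : 'rV[R]_n) : R :=
  (u *m A *m v^T) 0 0.

Record riemannian_metric (R : realType) (n : nat) (M : manifold R n) :=
  RiemannianMetric {
  metric_mx :> atlas M -> 'rV[R]_n -> 'M[R]_n;
  metric_smooth : forall i, smooth_on (img (chart_of i)) (metric_mx i);
  metric_sym : forall i x, img (chart_of i) x ->
    (metric_mx i x)^T = metric_mx i x;
  metric_pos : forall i x, img (chart_of i) x ->
    forall v, v != 0 -> 0 < form (metric_mx i x) v v;
  metric_transition : forall i j x,
    local_dom (chart_of i) (chart_of j) id x ->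
    let t := local_expr (chart_of i) (chart_of j) id in
    metric_mx i x = 'J t x *m metric_mx j (t x) *m ('J t x)^T
}.

Record almost_complex_structure (R : realType) (n : nat) (M : manifold R n) :=
  AlmostComplexStructure {
  acs_mx :> atlas M -> 'rV[R]_n -> 'M[R]_n;
  acs_smooth : forall i, smooth_on (img (chart_of i)) (acs_mx i);
  acs_sqr : forall i x, img (chart_of i) x ->
    acs_mx i x *m acs_mx i x = - 1%:M;
  acs_transition : forall i j x,
    local_dom (chart_of i) (chart_of j) id x ->
    let t := local_expr (chart_of i) (chart_of j) id in
    acs_mx i x *m 'J t x = 'J t x *m acs_mx j (t x)
}.

(* [m] is half the real dimension. *)
Record almost_hermitian (R : realType) (m : nat) := AlmostHermitian {
  underlying :> manifold R (m + m);
  metric : riemannian_metric underlying;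
  acs : almost_complex_structure underlying;
  acs_isometric : forall i x, img (chart_of i) x -> forall u v,
    form (metric i x) (u *m acs i x) (v *m acs i x) = form (metric i x) u v
}.

(* Calculus in a chart with metric matrix [G]. *)
Section ChartCalculus.
Context {R : realType} {n : nat}.
Implicit Types (G : 'rV[R]_n -> 'M[R]_n) (x u v w : 'rV[R]_n).

Definition koszul G x v w u : R :=
  2^-1 * (form ('D_v G x) w u + form ('D_w G x) v u - form ('D_u G x) v w).

(* The vector representing the linear form [koszul G x v w] in the metric
   [G x]; its components are the contractions of v and w with the Christoffel
   symbols.  See [levi_civita_unique] below. *)
Definition christoffel G x v w : 'rV[R]_n :=
  (\row_l koszul G x v w (delta_mx 0 l)) *m invmx (G x).

Definition nabla G x v (Y : 'rV[R]_n -> 'rV[R]_n) : 'rV[R]_n :=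
  'D_v Y x + christoffel G x v (Y x).

(* (nabla_v A)(w) = nabla_v (A w) - A (nabla_v w) for an endomorphism field A;
   being tensorial in w, it is computed on the extension of w with constant
   components. *)
Definition nabla_endo G (A : 'rV[R]_n -> 'M[R]_n) x v w : 'rV[R]_n :=
  nabla G x v (fun y => w *m A y) - nabla G x v (fun=> w) *m A x.

(* The second covariant derivative of a function, with w extended as above. *)
Definition hessian G (f : 'rV[R]_n -> R) x v w : R :=
  'D_v (fun y => 'D_w f y) x - 'D_(nabla G x v (fun=> w)) f x.

(* The rows of [e] form an orthonormal basis. *)
Definition orthonormal_frame (g : 'M[R]_n) (e : 'M[R]_n) : Prop :=
  forall j k, form g (row j e) (row k e) = (j == k)%:R.

End ChartCalculus.

Section AlongMap.
Context {R : realType} {n p : nat}.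
Implicit Types (G : 'rV[R]_n -> 'M[R]_n) (x v w : 'rV[R]_n).
Variables (H : 'rV[R]_p -> 'M[R]_p) (f : 'rV[R]_n -> 'rV[R]_p).

(* The connection induced on the pullback of the tangent bundle by f. *)
Definition nabla_along x v (V : 'rV[R]_n -> 'rV[R]_p) : 'rV[R]_p :=
  'D_v V x + christoffel H (f x) (v *m 'J f x) (V x).

Definition second_fundamental_form G x v w : 'rV[R]_p :=
  nabla_along x v (fun y => w *m 'J f y) - nabla G x v (fun=> w) *m 'J f x.

Definition tension G x (e : 'M[R]_n) : 'rV[R]_p :=
  \sum_j second_fundamental_form G x (row j e) (row j e).

End AlongMap.

(* The rows e_1, .., e_m of [e] are such that e_1, .., e_m, J e_1, .., J e_m
   is an orthonormal basis. *)
Definition adapted_frame {R : realType} {m : nat} (g J : 'M[R]_(m + m))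
    (e : 'M[R]_(m, m + m)) : Prop :=
  orthonormal_frame g (col_mx e (e *m J)).

Definition divergence {R : realType} {m : nat}
    (G J : 'rV[R]_(m + m) -> 'M[R]_(m + m)) (x : 'rV[R]_(m + m))
    (e : 'M[R]_(m, m + m)) : 'rV[R]_(m + m) :=
  \sum_k (nabla_endo G J x (row k e) (row k e) +
          nabla_endo G J x (row k e *m J x) (row k e *m J x)).

Definition cosymplectic {R : realType} {m : nat} (M : almost_hermitian R m) :
  Prop :=
  forall i x, img (chart_of i) x ->
  forall e, adapted_frame (metric M i x) (acs M i x) e ->
  divergence (metric M i) (acs M i) x e = 0.

Section HarmonicFunction.
Context {R : realType} {n : nat} {M : manifold R n}.
Variable g : riemannian_metric M.

Definition harmonic_function_on (U : set M) (f : M -> R) : Prop :=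
  forall i,
    let V := [set x | img (chart_of i) x /\ U (param (chart_of i) x)] in
    let fi := fun x => f (param (chart_of i) x) in
    smooth_on V fi /\
    forall x, V x -> forall e, orthonormal_frame (g i x) e ->
      \sum_j hessian (g i) fi x (row j e) (row j e) = 0.

End HarmonicFunction.

Definition smooth_map {R : realType} {n p : nat}
    {M : manifold R n} {N : manifold R p} (phi : M -> N) : Prop :=
  continuous phi /\
  forall i j, smooth_on (local_dom (chart_of i) (chart_of j) phi)
                        (local_expr (chart_of i) (chart_of j) phi).

Section RiemannianMaps.
Context {R : realType} {n p : nat} {M : manifold R n} {N : manifold R p}.
Variables (g : riemannian_metric M) (h : riemannian_metric N) (phi : M -> N).

Definition harmonic_map : Prop :=
  forall i j x, local_dom (chart_of i) (chart_of j) phi x ->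
  forall e, orthonormal_frame (g i x) e ->
  tension (h j) (local_expr (chart_of i) (chart_of j) phi) (g i) x e = 0.

Definition harmonic_morphism : Prop :=
  smooth_map phi /\
  forall (V : set N) (f : N -> R), open V -> harmonic_function_on h V f ->
    harmonic_function_on g (phi @^-1` V) (f \o phi).

(* [u] is orthogonal to the kernel of [D], for the inner product [G]. *)
Definition horizontal (G : 'M[R]_n) (D : 'M[R]_(n, p)) (u : 'rV[R]_n) : Prop :=
  forall v : 'rV[R]_n, v *m D = 0 -> form G u v = 0.

Definition horizontally_weakly_conformal : Prop :=
  forall i j x, local_dom (chart_of i) (chart_of j) phi x ->
  let f := local_expr (chart_of i) (chart_of j) phi in
  let hor := horizontal (g i x) ('J f x) in
  'J f x = 0 \/
  (exists2 lambda : R, 0 < lambda & forall u w, hor u -> hor w ->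
     form (h j (f x)) (u *m 'J f x) (w *m 'J f x)
       = lambda ^+ 2 * form (g i x) u w) /\
  (forall z : 'rV[R]_p, exists2 u, hor u & u *m 'J f x = z).

End RiemannianMaps.

Section AlmostHermitianMaps.
Context {R : realType} {m n : nat}.
Variables (M : almost_hermitian R m) (N : almost_hermitian R n) (phi : M -> N).

Definition holomorphic : Prop :=
  forall i j x, local_dom (chart_of i) (chart_of j) phi x ->
  let f := local_expr (chart_of i) (chart_of j) phi in
  acs M i x *m 'J f x = 'J f x *m acs N j (f x).

(* d phi (J (delta J)) = 0 *)
Definition J_divergence_vertical : Prop :=
  forall i j x, local_dom (chart_of i) (chart_of j) phi x ->
  let f := local_expr (chart_of i) (chart_of j) phi in
  forall e, adapted_frame (metric M i x) (acs M i x) e ->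
  divergence (metric M i) (acs M i) x e *m acs M i x *m 'J f x = 0.

End AlmostHermitianMaps.

(* [christoffel] is the Levi-Civita connection: a connection with symbols Gam
   is torsion free and metric at x if and only if Gam is [christoffel G x]. *)
Section LeviCivita.
Context {R : realType} {n : nat}.
Implicit Types (A B : 'M[R]_n) (u v w : 'rV[R]_n).

Lemma formDl A u v w : form A (u + v) w = form A u w + form A v w.
Proof. by rewrite /form !mulmxDl mxE. Qed.

Lemma formDr A u v w : form A u (v + w) = form A u v + form A u w.
Proof. by rewrite /form linearD /= mulmxDr mxE. Qed.

Lemma formZr A a u v : form A u (a *: v) = a * form A u v.
Proof. by rewrite /form linearZ /= -scalemxAr mxE. Qed.

Lemma form_mxD A B u v : form (A + B) u v = form A u v + form B u v.
Proof. by rewrite /form mulmxDr mulmxDl mxE. Qed.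

Lemma form_mxZ a A u v : form (a *: A) u v = a * form A u v.
Proof. by rewrite /form -scalemxAr -scalemxAl mxE. Qed.

Lemma form_sym A u v : A^T = A -> form A u v = form A v u.
Proof.
move=> symA; have -> : form A u v = ((u *m A *m v^T)^T) 0 0 by rewrite mxE.
by rewrite !trmx_mul trmxK symA mulmxA.
Qed.

Lemma derive_sym (G : 'rV[R]_n -> 'M[R]_n) x u : differentiable G x ->
  (\forall y \near x, (G y)^T = G y) -> ('D_u G x)^T = 'D_u G x.
Proof.
move=> dG sG; have cG v : derivable G x v by exact: diff_derivable.
apply/matrixP => a b; rewrite mxE !derive_mx// !mxE.
apply: near_eq_derive.
by near=> y; rewrite -[in LHS](near sG y)// mxE.
Unshelve. all: by end_near. Qed.

Lemma koszul_sum (G : 'rV[R]_n -> 'M[R]_n) x v w u : differentiable G x ->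
  koszul G x v w u = \sum_l koszul G x v w (delta_mx 0 l) * u 0 l.
Proof.
move=> dG.
have dE u1 : 'D_u1 G x = 'd G x u1 by rewrite deriveE.
have dD u1 u2 : 'D_(u1 + u2) G x = 'D_u1 G x + 'D_u2 G x.
  by rewrite !dE; exact: linearD.
have dZ a u1 : 'D_(a *: u1) G x = a *: 'D_u1 G x.
  by rewrite !dE; exact: linearZ.
have KD u1 u2 :
    koszul G x v w (u1 + u2) = koszul G x v w u1 + koszul G x v w u2.
  by rewrite /koszul dD; move: ('D_v G x) ('D_w G x) ('D_u1 G x) ('D_u2 G x)
    => A B C D; rewrite (formDr A) (formDr B) (form_mxD C); ring.
have KZ a u1 : koszul G x v w (a *: u1) = a * koszul G x v w u1.
  by rewrite /koszul dZ; move: ('D_v G x) ('D_w G x) ('D_u1 G x) => A B C;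
  rewrite (formZr A) (formZr B) (form_mxZ a C); ring.
have K0 : koszul G x v w 0 = 0 by rewrite -(scale0r 0) KZ mul0r.
rewrite {1}(row_sum_delta u) (big_morph _ KD K0).
by apply: eq_bigr => l _; rewrite KZ mulrC.
Qed.

Lemma form_christoffel (G : 'rV[R]_n -> 'M[R]_n) x v w u :
  differentiable G x -> G x \in unitmx ->
  form (G x) (christoffel G x v w) u = koszul G x v w u.
Proof.
move=> dG uG; rewrite (koszul_sum _ _ _ dG) /form /christoffel mulmxKV// mxE.
by apply: eq_bigr => l _; rewrite !mxE.
Qed.

Theorem levi_civita_unique (G : 'rV[R]_n -> 'M[R]_n) x
    (Gam : 'rV[R]_n -> 'rV[R]_n -> 'rV[R]_n) :
  differentiable G x -> G x \in unitmx ->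
  (\forall y \near x, (G y)^T = G y) ->
  ((forall v w, Gam v w = Gam w v) /\
   (forall u v w, form ('D_u G x) v w =
      form (G x) (Gam u v) w + form (G x) v (Gam u w)))
  <-> (forall v w, Gam v w = christoffel G x v w).
Proof.
move=> dG uG sG.
have sGx : (G x)^T = G x by exact: (nbhs_singleton sG).
have sD u v w : form ('D_u G x) v w = form ('D_u G x) w v.
  by rewrite form_sym// derive_sym.
have [F FE] : exists F : 'rV[R]_n -> 'rV[R]_n -> 'rV[R]_n -> R,
    forall u v w, form ('D_u G x) v w = F u v w.
  by exists (fun u v w => form ('D_u G x) v w).
have FC u v w : F u v w = F u w v by rewrite -!FE; exact: sD.
have cE v w u : form (G x) (christoffel G x v w) u =
    2^-1 * (F v w u + F w v u - F u v w).
  by rewrite -!FE; exact: form_christoffel.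
have inj a b : (forall u, form (G x) a u = form (G x) b u) -> a = b.
  move=> ab; apply: (can_inj (mulmxK uG)); apply/rowP => l.
  by have := ab (delta_mx 0 l); rewrite /form trmx_delta -!colE !mxE.
have formC a b : form (G x) a b = form (G x) b a by exact: form_sym.
split=> [[tf mc] v w|Gc].
- have mF u v' w' : F u v' w' =
      form (G x) (Gam u v') w' + form (G x) v' (Gam u w').
    by rewrite -FE; exact: mc.
  apply: inj => u; rewrite cE !mF.
  rewrite (formC w (Gam v u)) (formC v (Gam w u)) (formC v (Gam u w)).
  by rewrite (tf w v) (tf u v) (tf u w); field.
- split=> [v w|u v w]; rewrite !Gc.
  + by apply: inj => u; rewrite !cE (FC u v w) (addrC (F v w u)).
  + rewrite FE (formC v) !cE.
    by rewrite (FC v u w) (FC w u v) (FC u w v); field.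
Qed.

End LeviCivita.

(* Main.v *)
Require Import Defs.
From mathcomp Require Import all_boot all_order all_algebra.
From mathcomp Require Import all_classical all_reals all_analysis.
From mathcomp Require Import perm ring lra.
Import Defs.
Set Implicit Arguments.
Unset Strict Implicit.
Unset Printing Implicit Defensive.
Import Order.TTheory GRing.Theory Num.Theory.
Import numFieldNormedType.Exports.
Local Open Scope classical_set_scope.
Local Open Scope ring_scope.

(* Differentiating dphi o J = J^N o dphi gives, for all v and w,
     dphi((nabla_v J) w) + B(v, J w) = (nabla_{dphi v} J^N)(dphi w) + J^N B(v, w)
   with B the second fundamental form of phi.  Trace this over an orthonormal
   frame: the terms B(e, J e) cancel since B is symmetric, and horizontal weak
   conformality turns the trace of nabla J^N on the images dphi(e) into
   mu (delta J^N), where mu is the squared dilation.  Hence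
     dphi(delta J) = mu (delta J^N) + J^N tau(phi),
   from which two of the implications are immediate.  If phi is harmonic and
   dphi(J delta J) = 0, then dphi = 0 at every point over the open set where
   delta J^N does not vanish; so phi is locally constant there, and its image
   is countable because M is second countable.  As phi is onto, that open set
   is countable, hence empty.  Finally, the Laplacian of u o phi is
   mu (Laplacian of u) + du(tau(phi)), so a harmonic phi is a harmonic
   morphism. *)

(** * Directional derivatives: product rule, mean value theorem, symmetry of second derivatives *)

Section DirectionalDerivatives.
Context {R : realType} {V : normedModType R}.
Implicit Types (x u v w : V).

Lemma deriveDdir {W : normedModType R} (f : V -> W) x u v :
  differentiable f x -> 'D_(u + v) f x = 'D_u f x + 'D_v f x.
Proof. by move=> df; rewrite !deriveE// linearD. Qed.

Lemma deriveZdir {W : normedModType R} (f : V -> W) x a v :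
  differentiable f x -> 'D_(a *: v) f x = a *: 'D_v f x.
Proof. by move=> df; rewrite !deriveE// linearZ. Qed.

Lemma derive_entry {p q} (A : V -> 'M[R]_(p, q)) x v i j :
  derivable A x v -> ('D_v A x) i j = 'D_v (fun y => A y i j) x.
Proof. by move=> dA; rewrite derive_mx// mxE. Qed.

Lemma is_derive_mulmx {p q r} (A : V -> 'M[R]_(p, q)) (B : V -> 'M[R]_(q, r))
    x v : derivable A x v -> derivable B x v ->
  is_derive x v (fun y => A y *m B y)
    ('D_v A x *m B x + A x *m 'D_v B x).
Proof.
move=> dA dB; move/derivable_mxP: (dA) => eA; move/derivable_mxP: (dB) => eB.
have E i k : is_derive x v (fun y => (A y *m B y) i k)
    (('D_v A x *m B x + A x *m 'D_v B x) i k).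
  have -> : (fun y => (A y *m B y) i k) =
      \sum_(j < q) ((fun y => A y i j) * (fun y => B y j k)).
    apply/funext => y; rewrite mxE fct_sumE; exact: eq_bigr.
  rewrite !mxE -big_split/=; apply: is_derive_sum => j.
  apply: is_derive_eq.
    by apply: is_deriveM; apply: derivableP; [exact: eA|exact: eB].
  by rewrite !derive_entry// !/(_ *: _)/= addrC; congr (_ + _); rewrite mulrC.
have D : derivable (fun y => A y *m B y) x v.
  by apply/derivable_mxP => i k; have [] := E i k.
apply: DeriveDef => //; apply/matrixP => i k.
by rewrite derive_entry//; have [_ ->] := E i k.
Qed.

(** The two difference quotients are the same function of h. *)
Lemma is_derive_line {W : normedModType R} (f : V -> W) p v (s : R) d :
  is_derive (p + s *: v) v f d -> is_derive s 1 (fun t => f (p + t *: v)) d.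
Proof.
have E : (fun h : R => h^-1 *:
    (((fun t => f (p + t *: v)) \o shift s) (h *: 1) - f (p + s *: v))) =
    (fun h => h^-1 *: ((f \o shift (p + s *: v)) (h *: v) - f (p + s *: v))).
  apply/funext => h /=; congr (_ *: (f _ - _)).
  by rewrite [h *: 1]mulr1 scalerDl addrCA.
by move=> [fc fd]; apply: DeriveDef; rewrite /derivable/derive E.
Qed.

Lemma MVT_line (f : V -> R) p v (h : R) : 0 < h ->
  (forall s, 0 <= s <= h -> differentiable f (p + s *: v)) ->
  exists2 s, 0 < s < h & f (p + h *: v) - f p = h * 'D_v f (p + s *: v).
Proof.
move=> h0 df.
have D s : 0 <= s <= h ->
    is_derive s 1 (fun t => f (p + t *: v)) ('D_v f (p + s *: v)).
  by move=> /df d; apply/is_derive_line/derivableP/diff_derivable.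
have [||c cI] := @MVT R (fun t => f (p + t *: v))
    (fun s => 'D_v f (p + s *: v)) 0 h h0.
- by move=> s; rewrite in_itv/= => /andP[s0 sh]; apply: D; rewrite !ltW.
- apply: derivable_within_continuous => s; rewrite in_itv/= => /D[].
  by [].
rewrite scale0r addr0 subr0 mulrC => E.
by exists c => //; move: cI; rewrite in_itv.
Qed.

Lemma is_derive_translate {W : normedModType R} (f : V -> W) c x v d :
  is_derive (x + c) v f d -> is_derive x v (fun y => f (y + c)) d.
Proof.
have E : (fun h : R => h^-1 *:
    (((fun y => f (y + c)) \o shift x) (h *: v) - f (x + c))) =
    (fun h => h^-1 *: ((f \o shift (x + c)) (h *: v) - f (x + c))).
  by apply/funext => h /=; rewrite addrA.
by move=> [fc fd]; apply: DeriveDef; rewrite /derivable/derive E.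
Qed.

Lemma differentiable_translate {W : normedModType R} (f : V -> W) c x :
  differentiable f (x + c) -> differentiable (fun y => f (y + c)) x.
Proof.
by move=> df; apply: (@differentiable_comp _ _ _ _ (fun y => y + c) f).
Qed.

(* Mean value theorem for [y |-> f (y + h w) - f y] on the segment from x to
   x + h v. *)
Lemma second_difference (f : V -> R) x v w :
  (\forall y \near x, differentiable f y) ->
  differentiable ('D_v f) x ->
  forall e, 0 < e -> \forall h \near 0^'+,
    `|f (x + h *: v + h *: w) - f (x + h *: v) - f (x + h *: w) + f x
      - h ^+ 2 * 'D_w ('D_v f) x| <= h ^+ 2 * e.
Proof.
move=> df dvf e e0.
(* The increments [s *: v + h *: w] and [s *: v], at which ['D_v f] is expanded below, have norms
   adding up to at most [h * K]; the summand 1 makes K positive. *)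
set K := `|v| + `|w| + `|v| + 1.
have K0 : 0 < K by rewrite /K ltr_wpDl// !addr_ge0.
have eK : 0 < e / K by rewrite divr_gt0.
have o1 : \forall k \near (0 : V),
    `|'D_v f (k + x) - ('D_v f x + 'd ('D_v f) x k)| <= e / K * `|k|.
  by have /eqaddoP/(_ _ eK) := diff_locally dvf.
have d1 : \forall k \near (0 : V), differentiable f (k + x).
  by move: df; rewrite (near_shift 0 x); apply: filterS => k /=; rewrite subr0.
have [r /= r0 H] : exists2 r, 0 < r & forall k : V, `|k| < r ->
    `|'D_v f (x + k) - 'D_v f x - 'd ('D_v f) x k| <= e / K * `|k| /\
    differentiable f (x + k).
  have /nbhs_ballP[r /= r0 rH] : \forall k \near (0 : V),
      `|'D_v f (k + x) - ('D_v f x + 'd ('D_v f) x k)| <= e / K * `|k| /\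
      differentiable f (k + x) by exact: filterI o1 d1.
  exists r => // k kr; have [] := rH k.
    by rewrite -ball_normE/= sub0r normrN.
  by rewrite opprD addrA (addrC k).
near=> h.
have h0 : 0 < h by near: h; exact: nbhs_right_gt.
have hr : h < r / K by near: h; apply: nbhs_right_lt; rewrite divr_gt0.
have hK : h * K < r by rewrite -ltr_pdivlMr.
have n1 s : 0 <= s <= h -> `|s *: v| <= h * `|v|.
  by move=> /andP[s0 sh]; rewrite normrZ ger0_norm// ler_wpM2r.
have n2 s : 0 <= s <= h -> `|s *: v + h *: w| <= h * `|v| + h * `|w|.
  move=> sI; rewrite (le_trans (ler_normD _ _))// lerD ?n1//.
  by rewrite normrZ gtr0_norm.
have hKE : h * K = (h * `|v| + h * `|w|) + h * `|v| + h.
  by rewrite /K !mulrDr mulr1.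
have v0 : 0 <= h * `|v| by rewrite mulr_ge0// ltW.
have w0 : 0 <= h * `|w| by rewrite mulr_ge0// ltW.
have s1 s : 0 <= s <= h -> `|s *: v| < r by move/n1; lra.
have s2 s : 0 <= s <= h -> `|s *: v + h *: w| < r by move/n2; lra.
pose g := (fun y => f (y + h *: w)) - f.
have dg s : 0 <= s <= h -> differentiable g (x + s *: v).
  move=> sI; apply: differentiableB; last by have [] := H _ (s1 _ sI).
  by apply: differentiable_translate; rewrite -addrA; have [] := H _ (s2 _ sI).
have [s sI gE] := MVT_line h0 dg.
have {}sI : 0 <= s <= h by case/andP: sI => *; rewrite !ltW.
have [b1 dd1] := H _ (s1 _ sI); have [b2 dd2] := H _ (s2 _ sI).
have DgE : 'D_v g (x + s *: v) =
    'D_v f (x + (s *: v + h *: w)) - 'D_v f (x + s *: v).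
  apply: derive_val; apply: is_deriveB.
    apply: is_derive_translate; rewrite -addrA.
    exact/derivableP/diff_derivable.
  exact/derivableP/diff_derivable.
have -> : f (x + h *: v + h *: w) - f (x + h *: v) - f (x + h *: w) + f x =
    g (x + h *: v) - g x.
  rewrite /g !fctE; ring.
rewrite gE DgE [X in h ^+ 2 * X]deriveE//.
move: b1 b2; rewrite linearD/= [in 'd _ _ (h *: w)]linearZ/=.
set A := 'D_v f (x + (_ + _)); set B := 'D_v f (x + _); set C := 'D_v f x.
set P := 'd _ _ (s *: v); set Q := 'd _ _ w => b1 b2.
(* The error is h times the difference of two first-order remainders of ['D_v f] at x, whose linear
   parts differ by [h *: Q]. *)
have -> : h * (A - B) - h ^+ 2 * Q =
    h * ((A - C - (P + h *: Q)) - (B - C - P)).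
  by rewrite /(_ *: _)/=; ring.
rewrite normrM gtr0_norm// expr2 -mulrA ler_wpM2l ?(ltW h0)//.
rewrite (le_trans (ler_normB _ _))// (le_trans (lerD b2 b1))//.
have -> : h * e = e / K * (h * K).
  by rewrite mulrCA -mulrA mulVf ?lt0r_neq0// mulr1.
rewrite -mulrDr ler_wpM2l ?(ltW eK)//.
by have := n1 _ sI; have := n2 _ sI; lra.
Unshelve. all: by end_near. Qed.

(** The second difference is symmetric in v and w. Divided by [h ^+ 2], it is within [e / 2] of
    either mixed derivative for small positive h, so these differ by at most e, for every positive
    e. *)
Lemma derive_symmetric_real (f : V -> R) x v w :
  (\forall y \near x, differentiable f y) ->
  differentiable ('D_v f) x -> differentiable ('D_w f) x ->
  'D_w ('D_v f) x = 'D_v ('D_w f) x.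
Proof.
move=> df dv dw; apply/eqP; rewrite -subr_eq0 -normr_le0.
apply/ler_addgt0Pl => e e0; rewrite addr0.
have e2 : 0 < e / 2 by rewrite divr_gt0.
have N1 := @second_difference f x v w df dv _ e2.
have N2 := @second_difference f x w v df dw _ e2.
move: ('D_w ('D_v f) x) ('D_v ('D_w f) x) N1 N2 => A B N1 N2.
have [h [h0 [H1 H2]]] := @filter_ex _ _ (at_right_proper_filter (0 : R)) _
  (filterI (nbhs_right_gt (0 : R)) (filterI N1 N2)).
have h2 : 0 < h ^+ 2 by rewrite exprn_gt0.
rewrite -(ler_pM2l h2) -[h ^+ 2 in leLHS]gtr0_norm// -normrM.
have -> : h ^+ 2 * (A - B) =
  (f (x + h *: v + h *: w) - f (x + h *: v) - f (x + h *: w) + f x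
      - h ^+ 2 * B) -
  (f (x + h *: v + h *: w) - f (x + h *: v) - f (x + h *: w) + f x
      - h ^+ 2 * A) by ring.
rewrite (le_trans (ler_normB _ _))// [e in leRHS]splitr mulrDr lerD//.
have -> : x + h *: v + h *: w = x + h *: w + h *: v by rewrite addrAC.
suff -> : f (x + h *: w + h *: v) - f (x + h *: v) - f (x + h *: w) + f x =
  f (x + h *: w + h *: v) - f (x + h *: w) - f (x + h *: v) + f x by [].
ring.
Qed.

End DirectionalDerivatives.

(** The first-order expansion of f at x is also one of g, and a differential is unique. *)
Lemma near_eq_differentiable {R : realType} {V W : normedModType R}
    (f g : V -> W) x :
  {near x, f =1 g} -> differentiable f x -> differentiable g x.
Proof.
move=> fg df; have fgx := nbhs_singleton fg.
have E : g \o shift x = cst (g x) + 'd f x +o_ 0 id.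
  apply/eqaddoP => e e0; have /eqaddoP/(_ _ e0) := diff_locally df.
  have fg0 : \forall k \near (0 : V), f (k + x) = g (k + x).
    by move: fg; rewrite (near_shift 0 x); apply: filterS => k /=; rewrite subr0.
  by move: fg0; apply: filterS2 => k /= fk; rewrite !fctE/= fk fgx.
have cf := diff_continuous df.
have dE : 'd g x = 'd f x :> (V -> W) by exact: diff_unique.
by apply/diff_locallyP; rewrite dE.
Qed.

(** * Closure properties of functions of class C^k *)

Section SmoothFunctions.
Context {R : realType} {n : nat}.
Implicit Types (U : set 'rV[R]_n) (k : nat) (v x : 'rV[R]_n).

(** Openness of U turns equality on U into equality near each of its points, so the directional
    derivatives agree on U as well and the induction applies to them. *)
Lemma Ck_congr {W : normedModType R} k U (f g : 'rV[R]_n -> W) : open U ->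
  (forall x, U x -> f x = g x) -> Ck k U f -> Ck k U g.
Proof.
move=> oU; elim: k f g => [|k IH] f g fg /=.
  move=> cf x Ux; rewrite /prop_for /continuous_at -(fg _ Ux); apply: cvg_trans (cf x Ux).
  apply: (@near_eq_cvg _ _ (nbhs x)).
  exact: (filterS fg (open_nbhs_nbhs (conj oU Ux))).
have nfg x : U x -> {near x, f =1 g}.
  by move=> Ux; exact: (filterS fg (open_nbhs_nbhs (conj oU Ux))).
move=> [df Df]; split=> [x Ux|v].
  exact: near_eq_differentiable (nfg _ Ux) (df _ Ux).
by apply: IH (Df v) => x /nfg nx; exact: near_eq_derive.
Qed.

Lemma Ck_subset {W : normedModType R} k U U' (f : 'rV[R]_n -> W) :
  U' `<=` U -> Ck k U f -> Ck k U' f.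
Proof.
move=> UU; elim: k f => [|k IH] f /=; first by move=> cf x /UU/cf.
by move=> [df Df]; split=> [x /UU/df//|v]; exact: IH.
Qed.

(** Allows smoothness to be checked through a chart of the target that depends on the point. *)
Lemma Ck_local {W : normedModType R} k U (f : 'rV[R]_n -> W) :
  (forall x, U x -> exists2 U' : set 'rV[R]_n, U' x & Ck k U' f) -> Ck k U f.
Proof.
elim: k f => [|k IH] f /= H; first by move=> x /H[U' U'x]; exact.
split=> [x /H[U' U'x [+ _]]|v]; first exact.
by apply: IH => x /H[U' U'x [_ +]] => /(_ v); exists U'.
Qed.

Lemma Ck_weaken {W : normedModType R} k U (f : 'rV[R]_n -> W) :
  Ck k.+1 U f -> Ck k U f.
Proof.
elim: k f => [|k IH] f [df Df].
  by move=> x /df; exact: differentiable_continuous.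
by split=> // v; apply: IH; exact: Df.
Qed.

Lemma Ck_cst {W : normedModType R} k U (a : W) : Ck k U (fun=> a).
Proof.
elim: k a => [|k IH] a; first by move=> x _; exact: cst_continuous.
split=> [x _|v]; first exact: differentiable_cst.
rewrite [X in Ck _ _ X](_ : _ = fun=> 0) //.
by apply/funext => x; rewrite derive_cst.
Qed.

Lemma Ck_add {W : normedModType R} k U (f g : 'rV[R]_n -> W) : open U ->
  Ck k U f -> Ck k U g -> Ck k U (fun x => f x + g x).
Proof.
move=> oU; elim: k f g => [|k IH] f g.
  by move=> cf cg x Ux; apply: continuousD; [exact: cf|exact: cg].
move=> [df Df] [dg Dg]; split=> [x Ux|v].
  by apply: differentiableD; [exact: df|exact: dg].
apply: (Ck_congr oU) (IH _ _ (Df v) (Dg v)) => x Ux /=.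
by apply/esym/deriveD; apply: diff_derivable; [exact: df|exact: dg].
Qed.

Lemma Ck_mul k U (f g : 'rV[R]_n -> R) : open U ->
  Ck k U f -> Ck k U g -> Ck k U (fun x => f x * g x).
Proof.
move=> oU; elim: k f g => [|k IH] f g.
  by move=> cf cg x Ux; apply: continuousM; [exact: cf|exact: cg].
move=> fk gk; have [[df Df] [dg Dg]] := (fk, gk); split=> [x Ux|v].
  by apply: differentiableM; [exact: df|exact: dg].
(* The product rule involves f and g themselves besides their derivatives, hence [Ck_weaken]. *)
apply: (Ck_congr oU)
  (Ck_add oU (IH _ _ (Ck_weaken fk) (Dg v)) (IH _ _ (Ck_weaken gk) (Df v))).
move=> x Ux; apply/esym.
by apply: deriveM; apply: diff_derivable; [exact: df|exact: dg].
Qed.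

Lemma Ck_sum {W : normedModType R} k U p (f : 'I_p -> 'rV[R]_n -> W) : open U ->
  (forall i, Ck k U (f i)) -> Ck k U (fun x => \sum_i f i x).
Proof.
move=> oU; elim: p f => [|p IH] f H.
  by rewrite [X in Ck _ _ X](_ : _ = fun=> 0);
    [exact: Ck_cst|apply/funext => x; rewrite big_ord0].
rewrite [X in Ck _ _ X](_ : _ = fun x =>
  (\sum_(i < p) f (widen_ord (leqnSn p) i) x) + f ord_max x); last first.
  by apply/funext => x; rewrite big_ord_recr.
by apply: Ck_add => //; exact: IH.
Qed.

Lemma differentiable_entry {V : normedModType R} {p q} (A : V -> 'M[R]_(p, q))
  i j (x : V) : differentiable A x -> differentiable (fun y => A y i j) x.
Proof.
move=> dA; exact: (@differentiable_comp _ _ _ _ A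
  (fun N : 'M[R]_(p, q) => N i j) x dA (differentiable_coord _ i j)).
Qed.

Lemma Ck_entry k U p q (f : 'rV[R]_n -> 'M[R]_(p, q)) i j : open U ->
  Ck k U f -> Ck k U (fun x => f x i j).
Proof.
move=> oU; elim: k f => [|k IH] f.
  move=> cf x Ux.
  exact: (continuous_comp (cf x Ux) (@matrix_normedtype.coord_continuous _ _ _ i j (f x))).
move=> [df Df]; split=> [x Ux|v]; first exact: differentiable_entry (df x Ux).
apply: (Ck_congr oU) (IH _ (Df v)) => x Ux.
by rewrite derive_entry//; apply: diff_derivable; exact: df.
Qed.

End SmoothFunctions.

(** * The chain rule and smoothness of composites *)

Section ChainRule.
Context {R : realType} {n p : nat}.
Implicit Types (x v : 'rV[R]_n).

Lemma derive_comp {V W : normedModType R} (f : 'rV[R]_n -> V) (u : V -> W) x v :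
  differentiable f x -> differentiable u (f x) ->
  'D_v (fun y => u (f y)) x = 'D_('D_v f x) u (f x).
Proof.
move=> df du; have dc := differentiable_comp df du.
rewrite -[LHS]/('D_v (u \o f) x) deriveE// diff_comp// deriveE//=.
by rewrite deriveE.
Qed.

Lemma derive_row {W : normedModType R} (u : 'rV[R]_p -> W) y w :
  differentiable u y -> 'D_w u y = \sum_j w 0 j *: 'D_(delta_mx 0 j) u y.
Proof.
move=> du; rewrite deriveE// {1}(row_sum_delta w) linear_sum.
by apply: eq_bigr => j _; rewrite linearZ deriveE.
Qed.

(** A directional derivative of the composite is a sum of products of a component of ['D_v f] with a
    partial derivative of u composed with f. The induction therefore runs over all u, so as to reach
    these partial derivatives. *)
Lemma Ck_comp k (U : set 'rV[R]_n) (U' : set 'rV[R]_p)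
    (f : 'rV[R]_n -> 'rV[R]_p) (u : 'rV[R]_p -> R) : open U ->
  (forall x, U x -> U' (f x)) -> Ck k U f -> Ck k U' u ->
  Ck k U (fun x => u (f x)).
Proof.
move=> oU UU; elim: k f u UU => [|k IH] f u UU.
  move=> cf cu x Ux; exact: (continuous_comp (cf x Ux) (cu _ (UU _ Ux))).
move=> fk uk; have [[df Df] [du Du]] := (fk, uk); split=> [x Ux|v].
  exact: (differentiable_comp (df _ Ux) (du _ (UU _ Ux))).
have : Ck k U (fun x => \sum_j ('D_v f x) 0 j * 'D_(delta_mx 0 j) u (f x)).
  apply: Ck_sum => // j; apply: Ck_mul => //.
    by apply: Ck_entry => //; exact: Df.
  exact: (IH f ('D_(delta_mx 0 j) u) UU (Ck_weaken fk) (Du _)).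
apply: Ck_congr => // x Ux.
have dfx := df _ Ux; have dux := du _ (UU _ Ux).
by apply/esym; rewrite (derive_comp v dfx dux) (derive_row _ dux).
Qed.

End ChainRule.

(** * Traces of bilinear maps *)

Section BilinearTraces.
Context {R : realType} {n : nat}.

Definition bilinear_map {p q} {W : lmodType R}
    (B : 'rV[R]_p -> 'rV[R]_q -> W) : Prop :=
  (forall w, linear (B^~ w)) /\ (forall v, linear (B v)).

(* For K the inverse of a metric G, this is the trace of B over any
   G-orthonormal frame; see [bilin_trace_rows] and [orthonormal_inv]. *)
Definition bilin_trace {W : lmodType R} (K : 'M[R]_n)
    (B : 'rV[R]_n -> 'rV[R]_n -> W) : W :=
  \sum_a \sum_b K a b *: B (delta_mx 0 a) (delta_mx 0 b).

Lemma linear_row_sum {p} {W : lmodType R} (f : 'rV[R]_p -> W) v :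
  linear f -> f v = \sum_a v 0 a *: f (delta_mx 0 a).
Proof.
move=> lf; have fZ a u : f (a *: u) = a *: f u.
  have f0 : f 0 = 0.
    by have := lf (-1) 0 0; rewrite scaleN1r oppr0 addr0 scaleN1r addNr.
  by have := lf a u 0; rewrite !addr0 f0 addr0.
have f0 : f 0 = 0 by rewrite -(scale0r 0) fZ scale0r.
have fD u w : f (u + w) = f u + f w by rewrite -[u]scale1r lf !scale1r.
rewrite {1}(row_sum_delta v) (big_morph _ fD f0).
by apply: eq_bigr => a _; rewrite fZ.
Qed.

(** After expansion of the rows in the standard basis, the coefficient of B at the basis pair (a, b)
    is the sum over j of [E j a * F j b]. Two matrices cover sums of B(e, J e), with F = E J. *)
Lemma bilin_trace_rows {W : lmodType R} {k} (E F : 'M[R]_(k, n))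
    (B : 'rV[R]_n -> 'rV[R]_n -> W) : bilinear_map B ->
  \sum_j B (row j E) (row j F) = bilin_trace (E^T *m F) B.
Proof.
move=> [Bl Br]; rewrite /bilin_trace exchange_big/=.
under [RHS]eq_bigr do under eq_bigr do rewrite mxE scaler_suml.
under [RHS]eq_bigr do rewrite exchange_big/=.
rewrite [RHS]exchange_big/=; apply: eq_bigr => j _.
rewrite (linear_row_sum _ (Br _)); apply: eq_bigr => b _.
rewrite (linear_row_sum _ (Bl _)) scaler_sumr; apply: eq_bigr => a _.
by rewrite !mxE scalerA mulrC.
Qed.

Lemma bilin_traceZ {W : lmodType R} a K (B : 'rV[R]_n -> 'rV[R]_n -> W) :
  bilin_trace (a *: K) B = a *: bilin_trace K B.
Proof.
rewrite /bilin_trace scaler_sumr; apply: eq_bigr => i _.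
by rewrite scaler_sumr; apply: eq_bigr => j _; rewrite mxE scalerA.
Qed.

(** Exchanging the two summation indices shows that the trace is its own negative, and 2 is
    invertible in R. *)
Lemma bilin_trace_antisymmetric {W : lmodType R} K
    (B : 'rV[R]_n -> 'rV[R]_n -> W) :
  K^T = - K -> (forall v w, B v w = B w v) -> bilin_trace K B = 0.
Proof.
move=> KT Bs; have E : bilin_trace K B = - bilin_trace K B.
  rewrite {1}/bilin_trace exchange_big/= /bilin_trace -sumrN.
  apply: eq_bigr => a _; rewrite -sumrN; apply: eq_bigr => b _.
  have -> : K b a = - K a b by have /matrixP/(_ a b) := KT; rewrite !mxE.
  by rewrite scaleNr Bs.
apply/eqP; have : 2 *: bilin_trace K B == 0.
  by rewrite scaler_nat mulr2n {1}E addNr.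
by rewrite scaler_eq0 pnatr_eq0.
Qed.

End BilinearTraces.

(** * Frames, isometric complex structures and conformal maps in matrix form *)

Section Frames.
Context {R : realType}.

Lemma form_rows {n k l} (G : 'M[R]_n) (E : 'M[R]_(k, n)) (F : 'M[R]_(l, n)) i j :
  form G (row i E) (row j F) = (E *m G *m F^T) i j.
Proof.
rewrite /form tr_row -row_mul mxE [RHS]mxE.
by apply: eq_bigr => a _; rewrite !mxE.
Qed.

Lemma form_ext {n} (A B : 'M[R]_n) :
  (forall u v, form A u v = form B u v) -> A = B.
Proof.
move=> AB; apply/matrixP => i j.
have := AB (row i 1%:M) (row j 1%:M).
by rewrite !form_rows !trmx1 !mulmx1 !mul1mx.
Qed.

Lemma positive_unit {n} (G : 'M[R]_n) :
  (forall v, v != 0 -> 0 < form G v v) -> G \in unitmx.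
Proof.
move=> Gpos; rewrite -row_free_unit -kermx_eq0.
apply/negPn/negP => /rowV0Pn[v /sub_kermxP vG v0].
by have := Gpos v v0; rewrite /form vG mul0mx mxE ltxx.
Qed.

Lemma orthonormalP {n} (G E : 'M[R]_n) :
  orthonormal_frame G E <-> E *m G *m E^T = 1%:M.
Proof.
split=> [oE|oE j k]; last by rewrite form_rows oE mxE.
by apply/matrixP => j k; rewrite -form_rows oE mxE.
Qed.

(** [G *m E^T] is a right inverse of the square matrix E, hence also a left inverse. A trace over an
    orthonormal frame is thus a trace against [invmx G], whatever the frame. *)
Lemma orthonormal_inv {n} (G E : 'M[R]_n) : G \in unitmx ->
  orthonormal_frame G E -> E^T *m E = invmx G.
Proof.
move=> uG /orthonormalP; rewrite -mulmxA => /mulmx1C.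
by rewrite -mulmxA => GE; rewrite -[LHS](mulKmx uG) GE mulmx1.
Qed.

Lemma isometric_mx {n} (G J : 'M[R]_n) :
  (forall u v, form G (u *m J) (v *m J) = form G u v) -> J *m G *m J^T = G.
Proof.
move=> iJ; apply: form_ext => u v; rewrite -[RHS]iJ /form.
by rewrite trmx_mul !mulmxA.
Qed.

(** An isometry with square -1 is skew-adjoint: J G = - G J^T. Multiplying by [invmx G] on both
    sides gives the claim, which makes the sum of B(e, J e) over a frame vanish for symmetric B. *)
Lemma invmx_acs_antisymmetric {n} (G J : 'M[R]_n) : G \in unitmx -> G^T = G ->
  J *m J = - 1%:M -> J *m G *m J^T = G ->
  (invmx G *m J)^T = - (invmx G *m J).
Proof.
move=> uG sG JJ iJ; have uGi : (invmx G)^T = invmx G by rewrite trmx_inv sG.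
have JG : J *m G = - (G *m J^T).
  have : J *m (J *m G *m J^T) = J *m G by rewrite iJ.
  by rewrite !mulmxA JJ !mulNmx mul1mx => <-.
have GJ : J^T *m invmx G = - (invmx G *m J).
  have : invmx G *m (J *m G) *m invmx G = invmx G *m J.
    by rewrite mulmxA mulmxK.
  by rewrite JG mulmxN mulNmx mulmxA mulVmx// mul1mx => <-; rewrite opprK.
by rewrite trmx_mul uGi.
Qed.

(** Gram-Schmidt adapted to J: vectors are added one at a time, each orthogonal to the previous ones
    and to their images under J. *)
Lemma adapted_frame_exists {m} (G J : 'M[R]_(m + m)) : G^T = G ->
  (forall v, v != 0 -> 0 < form G v v) -> J *m J = - 1%:M ->
  J *m G *m J^T = G -> exists e, adapted_frame G J e.
Proof.
move=> sG Gpos JJ iJ.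
have JG : J *m G = - (G *m J^T).
  have : J *m (J *m G *m J^T) = J *m G by rewrite iJ.
  by rewrite !mulmxA JJ !mulNmx mul1mx => <-.
(* It is enough that the rows of e be orthonormal, and orthogonal to those of [e *m J]: the latter
   are then orthonormal because J is isometric. *)
have [e [e1 e2]] : exists e : 'M[R]_(m, m + m),
    e *m G *m e^T = 1%:M /\ e *m G *m (e *m J)^T = 0.
  suff X k : (k <= m)%N -> exists e : 'M[R]_(k, m + m),
    e *m G *m e^T = 1%:M /\ e *m G *m (e *m J)^T = 0 by exact: X.
  elim: k => [|k IH] km.
    by exists 0; split; [apply/matrixP => -[]|rewrite !mul0mx].
  have [e [e1 e2]] := IH (ltnW km).
  have [v v0 vX] : exists2 v : 'rV[R]_(m + m), v != 0 &
      v *m G *m (col_mx e (e *m J))^T = 0.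
    (* The vector v has to satisfy 2k linear conditions in dimension 2m, and k < m. *)
    have : kermx (G *m (col_mx e (e *m J))^T) != 0.
      rewrite -mxrank_eq0 mxrank_ker subn_eq0 -ltnNge.
      by rewrite (leq_ltn_trans (rank_leq_col _))// -addSn leq_add// ltnW.
    by move=> /rowV0Pn[v /sub_kermxP]; rewrite mulmxA; exists v.
  move: vX; rewrite tr_col_mx mul_mx_row -row_mx0 => /eq_row_mx[ve veJ].
  pose c := (Num.sqrt (form G v v))^-1.
  have c1 : c ^+ 2 * form G v v = 1.
    by rewrite exprVn sqr_sqrtr ?ltW ?Gpos// mulVf// gt_eqF// Gpos.
  have GT (A B : 'rV[R]_(m + m)) : A *m G *m B^T = (form G A B)%:M.
    by rewrite [LHS]mx11_scalar.
  rewrite -[k.+1]add1n; exists (col_mx (c *: v) e); split.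
    rewrite mul_col_mx tr_col_mx mul_col_row -!scalemxAl ve scaler0.
    rewrite linearZ/= -!scalemxAr scalerA -expr2 e1.
    have -> : e *m G *m v^T = 0.
      by apply: trmx_inj; rewrite !trmx_mul trmxK sG mulmxA ve trmx0.
    by rewrite scaler0 GT scale_scalar_mx c1 -scalar_mx_block.
  rewrite mul_col_mx [col_mx _ _ *m J]mul_col_mx tr_col_mx mul_col_row -!scalemxAl veJ scaler0 e2.
  (* By skew-adjointness of J, [form G v (v *m J)] is its own negative. *)
  have -> : v *m G *m (c *: (v *m J))^T = 0.
    have : (v *m J) *m G *m v^T = - (v *m G *m (v *m J)^T).
      by rewrite -(mulmxA v J) JG mulmxN mulNmx trmx_mul !mulmxA.
    rewrite !GT (form_sym _ _ sG) => /matrixP/(_ 0 0).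
    rewrite !mxE eqxx !mulr1n => E; rewrite formZr.
    suff -> : form G v (v *m J) = 0 by rewrite mulr0 raddf0.
    lra.
  (* Skew-adjointness again: v is orthogonal to the rows of [e *m J], so J v is orthogonal to those
     of e. *)
  have -> : e *m G *m (c *: (v *m J))^T = 0.
    rewrite linearZ/= -scalemxAr; apply/eqP; rewrite scaler_eq0; apply/orP.
    right; apply/eqP/trmx_inj; rewrite !trmx_mul !trmxK sG -mulmxA.
    by rewrite (mulmxA J) JG mulNmx mulmxN -!mulmxA -trmx_mul mulmxA veJ
      oppr0 trmx0.
  by rewrite scaler0 block_mx0.
exists e; apply/orthonormalP; rewrite mul_col_mx tr_col_mx mul_col_row e1 e2.
have -> : e *m J *m G *m e^T = 0.
  by apply: trmx_inj; rewrite trmx_mul trmxK trmx_mul sG mulmxA e2 trmx0.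
have -> : e *m J *m G *m (e *m J)^T = 1%:M.
  by rewrite trmx_mul mulmxA -(mulmxA e J) -(mulmxA e (J *m G)) iJ.
by rewrite -scalar_mx_block.
Qed.

(** Here mu is the squared dilation, and 0 at a critical point. At a regular point the conformality
    relation is evaluated on a horizontal lift of an arbitrary z and on the horizontal vector
    [z' *m D^T *m invmx G], which gives H P = lambda^2. *)
Lemma conformal_gram {n p} (G : 'M[R]_n) (H : 'M[R]_p) (D : 'M[R]_(n, p)) :
  G \in unitmx -> G^T = G -> H \in unitmx ->
  D = 0 \/
  (exists2 lambda : R, 0 < lambda &
    forall u w, horizontal G D u -> horizontal G D w ->
      form H (u *m D) (w *m D) = lambda ^+ 2 * form G u w) /\
  (forall z : 'rV[R]_p, exists2 u, horizontal G D u & u *m D = z) ->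
  exists2 mu, (mu = 0 -> D = 0) & D^T *m invmx G *m D = mu *: invmx H.
Proof.
move=> uG sG uH [-> | [[l l0 conf] surj]].
  by exists 0; rewrite ?mulmx0 ?scale0r.
exists (l ^+ 2) => [/eqP|]; first by rewrite expf_eq0/= gt_eqF.
have sGi : (invmx G)^T = invmx G by rewrite trmx_inv sG.
set P := D^T *m invmx G *m D.
have PT : P^T = P by rewrite /P !trmx_mul trmxK sGi mulmxA.
have PE : P = D^T *m invmx G *m D by []; move: P PT PE => P PT PE.
suff HP : H *m P = (l ^+ 2)%:M.
  by rewrite -[P](mulKmx uH) HP mul_mx_scalar.
apply: form_ext => z z'; have [u hu uD] := surj z.
(* In the metric G this vector represents the linear form v |-> z' (v D)^T, which vanishes on the
   kernel of D. *)
have hw : horizontal G D (z' *m D^T *m invmx G).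
  move=> v vD; rewrite /form mulmxKV// -mulmxA -trmx_mul vD.
  by rewrite trmx0 mulmx0 mxE.
have := conf _ _ hu hw; rewrite uD.
have -> : z' *m D^T *m invmx G *m D = z' *m P by rewrite PE !mulmxA.
rewrite /form !trmx_mul PT sGi trmxK !mulmxA mulmxK// uD => ->.
by rewrite mul_mx_scalar -scalemxAl [RHS]mxE.
Qed.

End Frames.

(* Otherwise unifying 'D_v ('D_w f) with 'D_w ('D_v f) unfolds both limits. *)
Local Opaque derive.

(** * Second derivatives as symmetric bilinear maps *)

Section SecondDerivatives.
Context {R : realType} {V : normedModType R}.

Definition twice_differentiable {W : normedModType R} (f : V -> W) x : Prop :=
  (\forall y \near x, differentiable f y) /\
  forall w, differentiable ('D_w f) x.

(** Linearity in v comes from differentiability of ['D_w f] at x; linearity in w takes place under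
    the outer derivative and uses differentiability of f near x. *)
Lemma derive2_bilinear {W : normedModType R} (f : V -> W) x :
  twice_differentiable f x ->
  (forall w, linear (fun v => 'D_v ('D_w f) x)) /\
  (forall v, linear (fun w => 'D_v ('D_w f) x)).
Proof.
move=> [df ddf]; split=> [w|v] a u1 u2.
  by rewrite deriveDdir// deriveZdir.
have D w : derivable ('D_w f) x v by exact: diff_derivable.
rewrite -deriveZ// -deriveD//; last exact: derivableZ.
apply: near_eq_derive; move: df; apply: filterS => y dfy.
by rewrite deriveDdir// deriveZdir.
Qed.

Lemma derive_symmetric {p} (f : V -> 'rV[R]_p) x v w :
  twice_differentiable f x -> 'D_w ('D_v f) x = 'D_v ('D_w f) x.
Proof.
move=> [df ddf]; have dD u u' : derivable ('D_u f) x u' by exact: diff_derivable.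
have De u u' j : ('D_u' ('D_u f) x) 0 j = 'D_u' ('D_u (fun y => f y 0 j)) x.
  rewrite derive_entry//; apply: near_eq_derive; move: df; apply: filterS => y ?.
  by rewrite derive_entry//; exact: diff_derivable.
apply/rowP => j; refine (etrans (De v w j) (etrans _ (esym (De w v j)))).
apply: (@derive_symmetric_real _ _ (fun y => f y 0 j) x v w).
- by move: df; apply: filterS => y ?; exact: differentiable_entry.
- apply: (@near_eq_differentiable _ _ _ (fun y => ('D_v f y) 0 j)).
    move: df; apply: filterS => y ?.
    by rewrite derive_entry//; exact: diff_derivable.
  exact: differentiable_entry.
- apply: (@near_eq_differentiable _ _ _ (fun y => ('D_w f y) 0 j)).
    move: df; apply: filterS => y ?.
    by rewrite derive_entry//; exact: diff_derivable.
  exact: differentiable_entry.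
Qed.

End SecondDerivatives.

(** Covariant derivatives of endomorphism fields and second fundamental forms both consist of two
    terms minus a third, each linear; this regroups them in proofs of bilinearity. *)
Lemma scaler_addsub {R : nzRingType} {W : lmodType R} a
    (x1 x2 y1 y2 z1 z2 : W) :
  a *: x1 + x2 + (a *: y1 + y2) - (a *: z1 + z2) =
  a *: (x1 + y1 - z1) + (x2 + y2 - z2).
Proof.
by rewrite scalerBr scalerDr opprD (addrACA (a *: x1)) [LHS]addrACA.
Qed.

(** * The connection, covariant derivatives and the Hessian in a chart *)

Section Connections.
Context {R : realType} {n : nat}.
Implicit Types (G A : 'rV[R]_n -> 'M[R]_n) (x u v w : 'rV[R]_n).

(** This is the torsion-free half of [levi_civita_unique], applied to [christoffel G x] itself. *)
Lemma christoffel_sym G x v w : differentiable G x -> G x \in unitmx ->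
  (\forall y \near x, (G y)^T = G y) -> christoffel G x v w = christoffel G x w v.
Proof.
by move=> dG uG sG; have [_ /(_ (fun=> fun=> erefl))[]] :=
  levi_civita_unique (christoffel G x) dG uG sG.
Qed.

Lemma formZl (A : 'M[R]_n) a u v : form A (a *: u) v = a * form A u v.
Proof. by rewrite /form -!scalemxAl mxE. Qed.

Lemma christoffel_bilinear G x : differentiable G x ->
  bilinear_map (christoffel G x).
Proof.
move=> dG; split=> [w|v] a u1 u2; rewrite /christoffel scalemxAl -mulmxDl.
  congr (_ *m _); apply/rowP => l; rewrite !mxE /koszul deriveDdir// deriveZdir//.
  move: ('D_u1 G x) ('D_u2 G x) ('D_w G x) ('D_(delta_mx 0 l) G x) => A B C E.
  rewrite (form_mxD (a *: A)) (form_mxZ a A) (formDl C) (formZl C).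
  by rewrite (formDl E) (formZl E); ring.
congr (_ *m _); apply/rowP => l; rewrite !mxE /koszul deriveDdir// deriveZdir//.
move: ('D_u1 G x) ('D_u2 G x) ('D_v G x) ('D_(delta_mx 0 l) G x) => A B C E.
rewrite (form_mxD (a *: A)) (form_mxZ a A) (formDl C) (formZl C).
by rewrite (formDr E) (formZr E); ring.
Qed.

Lemma nabla_endoE G A x v w : derivable A x v ->
  nabla_endo G A x v w = w *m 'D_v A x + christoffel G x v (w *m A x)
    - christoffel G x v w *m A x.
Proof.
move=> dA; rewrite /nabla_endo /nabla derive_cst add0r.
have [_ ->] := is_derive_mulmx (derivable_cst w x v) dA.
by rewrite derive_cst mul0mx add0r.
Qed.

Lemma nabla_endo_bilinear G A x : differentiable G x -> differentiable A x ->
  bilinear_map (nabla_endo G A x).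
Proof.
move=> /christoffel_bilinear[Cl Cr] dA.
have dAv v : derivable A x v by exact: diff_derivable.
split=> [w|v] a u1 u2; rewrite !nabla_endoE//.
  rewrite deriveDdir// deriveZdir// !Cl mulmxDr mulmxDl -scalemxAr -scalemxAl.
  exact: scaler_addsub.
rewrite !mulmxDl -!scalemxAl !Cr !mulmxDl -!scalemxAl.
exact: scaler_addsub.
Qed.

Lemma hessianE G (f : 'rV[R]_n -> R) x v w :
  hessian G f x v w = 'D_v ('D_w f) x - 'D_(christoffel G x v w) f x.
Proof. by rewrite /hessian /nabla derive_cst add0r. Qed.

(** [R^o] is R as a module over itself, so that the trace lemmas apply to the Hessian. *)
Lemma hessian_bilinear G (f : 'rV[R]_n -> R) x : differentiable G x ->
  twice_differentiable f x ->
  bilinear_map (hessian G f x : 'rV[R]_n -> 'rV[R]_n -> R^o).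
Proof.
move=> /christoffel_bilinear[Cl Cr] f2; have [Dl Dr] := derive2_bilinear f2.
have dfx : differentiable f x by have [/nbhs_singleton] := f2.
split=> [w|v] a u1 u2; rewrite !hessianE.
  rewrite (Dl w a u1 u2) (Cl w a u1 u2) (deriveDdir _ _ dfx).
  rewrite (deriveZdir _ _ dfx).
  move: ('D_u1 ('D_w f) x) ('D_u2 ('D_w f) x) => b1 b2.
  by rewrite opprD addrACA -scalerBr.
rewrite (Dr v a u1 u2) (Cr v a u1 u2) (deriveDdir _ _ dfx).
rewrite (deriveZdir _ _ dfx).
move: ('D_v ('D_u1 f) x) ('D_v ('D_u2 f) x) => b1 b2.
by rewrite opprD addrACA -scalerBr.
Qed.

End Connections.

(** * Second fundamental form of a map and second-order chain rules *)

Section Maps.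
Context {R : realType} {n p : nat}.
Variables (G : 'rV[R]_n -> 'M[R]_n) (H : 'rV[R]_p -> 'M[R]_p).
Variables (f : 'rV[R]_n -> 'rV[R]_p) (x : 'rV[R]_n).
Hypotheses (f2 : twice_differentiable f x).
Implicit Types (v w : 'rV[R]_n).

Let D := 'J f x.

Let dfx : differentiable f x. Proof. by have [/nbhs_singleton] := f2. Qed.

Lemma jacobian_derivable v : derivable (jacobian f) x v.
Proof.
apply/derivable_mxP => i j; have [df ddf] := f2.
apply: (@near_eq_derivable _ _ _ (fun y => ('D_(delta_mx 0 i) f y) 0 j)).
  move: df; apply: filterS => y dfy.
  by rewrite deriveEjacobian// -rowE mxE.
by apply: diff_derivable; exact: differentiable_entry.
Qed.

Lemma derive_jacobian v w : 'D_v (fun y => w *m 'J f y) x = 'D_v ('D_w f) x.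
Proof.
have [df _] := f2; apply: near_eq_derive; move: df; apply: filterS => y dfy.
by rewrite deriveEjacobian.
Qed.

Lemma mul_derive_jacobian v w : w *m 'D_v (jacobian f) x = 'D_v ('D_w f) x.
Proof.
rewrite -derive_jacobian.
have [_ ->] := is_derive_mulmx (derivable_cst w x v) (@jacobian_derivable v).
by rewrite derive_cst mul0mx add0r.
Qed.

Lemma second_fundamental_formE v w :
  second_fundamental_form H f G x v w = 'D_v ('D_w f) x
    + christoffel H (f x) (v *m D) (w *m D) - christoffel G x v w *m D.
Proof.
by rewrite /second_fundamental_form /nabla_along derive_jacobian /nabla
  derive_cst add0r.
Qed.

Hypotheses (dG : differentiable G x) (dH : differentiable H (f x)).

Lemma second_fundamental_form_bilinear :
  bilinear_map (second_fundamental_form H f G x).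
Proof.
have [Dl Dr] := derive2_bilinear f2.
have [Gl Gr] := christoffel_bilinear dG.
have [Hl Hr] := christoffel_bilinear dH.
split=> [w|v] a u1 u2; rewrite !second_fundamental_formE.
  rewrite (Dl w a u1 u2) (Gl w a u1 u2).
  by rewrite !mulmxDl -!scalemxAl (Hl _ a) scaler_addsub.
rewrite (Dr v a u1 u2) (Gr v a u1 u2).
by rewrite !mulmxDl -!scalemxAl (Hr _ a) scaler_addsub.
Qed.

Lemma second_fundamental_form_sym v w : G x \in unitmx -> H (f x) \in unitmx ->
  (\forall y \near x, (G y)^T = G y) ->
  (\forall z \near f x, (H z)^T = H z) ->
  second_fundamental_form H f G x v w = second_fundamental_form H f G x w v.
Proof.
move=> uG uH sG sH; rewrite !second_fundamental_formE.
rewrite (christoffel_sym _ _ dG uG sG) (christoffel_sym _ _ dH uH sH).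
by rewrite (derive_symmetric w v f2).
Qed.

(* Obtained by differentiating [A *m 'J f = 'J f *m (B \o f)]. *)
Lemma holomorphic_second_order (A : 'rV[R]_n -> 'M[R]_n)
    (B : 'rV[R]_p -> 'M[R]_p) v w :
  differentiable A x -> differentiable B (f x) ->
  (\forall y \near x, A y *m 'J f y = 'J f y *m B (f y)) ->
  nabla_endo G A x v w *m D + second_fundamental_form H f G x v (w *m A x) =
  nabla_endo H B (f x) (v *m D) (w *m D)
    + second_fundamental_form H f G x v w *m B (f x).
Proof.
move=> dA dB hol; have ADB := nbhs_singleton hol.
have dBf : differentiable (fun y => B (f y)) x := differentiable_comp dfx dB.
have dAv : derivable A x v by exact: diff_derivable.
have dBv : derivable B (f x) (v *m D) by exact: diff_derivable.
have dBfv : derivable (fun y => B (f y)) x v by exact: diff_derivable.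
have E : 'D_v A x *m D + A x *m 'D_v (jacobian f) x =
    'D_v (jacobian f) x *m B (f x) + D *m 'D_(v *m D) B (f x).
  have := near_eq_derive v hol.
  have [_ ->] := is_derive_mulmx dAv (@jacobian_derivable v).
  have [_ ->] := is_derive_mulmx (@jacobian_derivable v) dBfv.
  by rewrite (derive_comp v dfx dB) deriveEjacobian.
have {E} : w *m ('D_v A x *m D) + 'D_v ('D_(w *m A x) f) x =
    'D_v ('D_w f) x *m B (f x) + w *m D *m 'D_(v *m D) B (f x).
  rewrite -!mul_derive_jacobian -(mulmxA w (A x)) -mulmxDr E mulmxDr.
  by rewrite !mulmxA.
rewrite !second_fundamental_formE !nabla_endoE// !mulmxBl !mulmxDl.
(* Holomorphy at x itself aligns the Christoffel terms of both sides; once they cancel, the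
   differentiated relation remains. *)
rewrite -(mulmxA w (A x)) ADB -/D (mulmxA w D).
rewrite -(mulmxA (christoffel G x v w) (A x)) ADB -/D.
rewrite -(mulmxA (christoffel G x v w) D).
rewrite -(mulmxA w _ D).
move: (w *m ('D_v A x *m D)) ('D_v ('D_(w *m A x) f) x)
  ('D_v ('D_w f) x *m B (f x)) (w *m D *m 'D_(v *m D) B (f x))
  (christoffel G x v w *m (D *m B (f x))) (christoffel G x v (w *m A x) *m D)
  (christoffel H (f x) (v *m D) (w *m D *m B (f x)))
  (christoffel H (f x) (v *m D) (w *m D) *m B (f x)) => a b c d e g h k.
by move=> /rowP abcd; apply/rowP => l; have := abcd l; rewrite !mxE; lra.
Qed.

(** Differentiating the first-order chain rule gives the second derivative of u along the images of
    v and w, plus the derivative of u along that of f. The Christoffel terms of H occur in both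
    summands on the right with opposite signs. *)
Lemma hessian_comp (u : 'rV[R]_p -> R) v w :
  twice_differentiable u (f x) ->
  hessian G (fun y => u (f y)) x v w = hessian H u (f x) (v *m D) (w *m D)
    + 'D_(second_fundamental_form H f G x v w) u (f x).
Proof.
move=> u2; have [df ddf] := f2; have [du ddu] := u2.
have dux : differentiable u (f x) by exact: (nbhs_singleton du).
have duf : differentiable (fun y => u (f y)) x := differentiable_comp dfx dux.
have DE y v' : differentiable f y -> 'D_v' f y = v' *m 'J f y.
  exact: deriveEjacobian.
have DvE : 'D_v f x = v *m D by exact: DE.
have DwE : 'D_w f x = w *m D by exact: DE.
have E1 : 'D_v ('D_w (fun y => u (f y))) x =
    'D_v (fun y => \sum_j ('D_w f y) 0 j * 'D_(delta_mx 0 j) u (f y)) x.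
  apply: near_eq_derive.
  have := differentiable_continuous dfx du; move: df; apply: filterS2 => y dfy duy.
  by rewrite (derive_comp w dfy duy) (derive_row _ duy).
have E2 : 'D_v (fun y => \sum_j ('D_w f y) 0 j * 'D_(delta_mx 0 j) u (f y)) x =
    'D_('D_v ('D_w f) x) u (f x) + 'D_(v *m D) ('D_(w *m D) u) (f x).
  have dc j : differentiable (fun y => ('D_w f y) 0 j) x.
    exact: differentiable_entry.
  have du' j : differentiable (fun y => 'D_(delta_mx 0 j) u (f y)) x.
    exact: (differentiable_comp dfx (ddu _)).
  have T1 j : 'D_v (fun y => ('D_w f y) 0 j) x = ('D_v ('D_w f) x) 0 j.
    by apply/esym/derive_entry; exact: diff_derivable.
  have T2 j : 'D_v (fun y => 'D_(delta_mx 0 j) u (f y)) x =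
      'D_(v *m D) ('D_(delta_mx 0 j) u) (f x).
    by rewrite -DvE; exact: (derive_comp v dfx (ddu _)).
  rewrite (derive_row _ dux) (linear_row_sum _ ((derive2_bilinear u2).2 _)).
  rewrite -DwE -big_split/=.
  have -> : (fun y => \sum_j ('D_w f y) 0 j * 'D_(delta_mx 0 j) u (f y)) =
      \sum_j ((fun y => ('D_w f y) 0 j) *
              (fun y => 'D_(delta_mx 0 j) u (f y))).
    by apply/funext => y; rewrite fct_sumE.
  rewrite derive_sum; last by move=> j; apply/diff_derivable/differentiableM.
  apply: eq_bigr => j _.
  move: (T1 j) (T2 j) (dc j) (du' j).
  pose a := fun y => ('D_w f y) 0 j.
  pose b := fun y => 'D_(delta_mx 0 j) u (f y).
  rewrite -/a -/b -[('D_w f x) 0 j]/(a x) -['D_(delta_mx 0 j) u (f x)]/(b x).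
  move: a b (('D_v ('D_w f) x) 0 j)
    ('D_(v *m D) ('D_(delta_mx 0 j) u) (f x)) => a b P Q aP bQ da db.
  rewrite deriveM; [|exact: diff_derivable|exact: diff_derivable].
  by rewrite aP bQ addrC; congr (_ + _); exact: mulrC.
rewrite !hessianE E1 E2 second_fundamental_formE.
rewrite (derive_comp _ dfx dux) (DE _ _ dfx) -/D.
rewrite -[_ - christoffel G x v w *m D]addrA (deriveDdir _ _ dux).
rewrite (deriveDdir _ _ dux) -(scaleN1r (christoffel G x v w *m D)) (deriveZdir _ _ dux) scaleN1r.
move: ('D_('D_v ('D_w f) x) u (f x)) ('D_(v *m D) ('D_(w *m D) u) (f x))
  ('D_(christoffel G x v w *m D) u (f x))
  ('D_(christoffel H (f x) (v *m D) (w *m D)) u (f x)) => a b c d.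
ring.
Qed.

End Maps.

(** * Continuity of matrix products, determinants and inverses *)

Section MatrixContinuity.
Context {R : realType} {T : topologicalType}.
Implicit Types (x : T).

Lemma continuous_at_sum {I : Type} {W : normedModType R} (r : seq I) (f : I -> T -> W) x :
  (forall i, {for x, continuous (f i)}) ->
  {for x, continuous (fun y => \sum_(i <- r) f i y)}.
Proof.
move=> cf; elim: r => [|i r IH].
  rewrite [X in {for _, continuous X}](_ : _ = fun=> 0); first exact: cst_continuous.
  by apply/funext => y; rewrite big_nil.
rewrite [X in {for _, continuous X}](_ : _ = fun y => f i y + \sum_(i <- r) f i y).
  exact: continuousD (cf i) IH.
by apply/funext => y; rewrite big_cons.
Qed.

Lemma continuous_at_prod {I : Type} (r : seq I) (f : I -> T -> R) x :
  (forall i, {for x, continuous (f i)}) ->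
  {for x, continuous (fun y => \prod_(i <- r) f i y)}.
Proof.
move=> cf; elim: r => [|i r IH].
  rewrite [X in {for _, continuous X}](_ : _ = fun=> 1); first exact: cst_continuous.
  by apply/funext => y; rewrite big_nil.
rewrite [X in {for _, continuous X}](_ : _ = fun y => f i y * \prod_(i <- r) f i y).
  exact: continuousM (cf i) IH.
by apply/funext => y; rewrite big_cons.
Qed.

Lemma continuous_mxP {p q} (A : T -> 'M[R]_(p, q)) x :
  {for x, continuous A} <-> forall i j, {for x, continuous (fun y => A y i j)}.
Proof.
split=> [cA i j|cA].
  exact: (@continuous_comp _ _ _ A (fun N : 'M[R]_(p, q) => N i j) x cA
    (@matrix_normedtype.coord_continuous R p q i j (A x))).
apply/cvgrPdist_le => /= e e0; near=> y.
rewrite /Num.Def.normr/= mx_normrE (bigmax_le _ (ltW e0))//= => i _.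
rewrite !mxE/=; move: i; near: y; apply: filter_forall => /= i.
exact: ((cvgrPdist_le _ _).1 (cA i.1 i.2)).
Unshelve. all: by end_near. Qed.

Lemma continuous_mulmx {p q r} (A : T -> 'M[R]_(p, q)) (B : T -> 'M[R]_(q, r)) x :
  {for x, continuous A} -> {for x, continuous B} ->
  {for x, continuous (fun y => A y *m B y)}.
Proof.
move=> /continuous_mxP cA /continuous_mxP cB; apply/continuous_mxP => i j.
rewrite [X in {for _, continuous X}](_ : _ = fun y => \sum_k A y i k * B y k j).
  by apply: continuous_at_sum => k; exact: continuousM.
by apply/funext => y; rewrite mxE.
Qed.

Lemma continuous_det {p} (A : T -> 'M[R]_p) x :
  {for x, continuous A} -> {for x, continuous (fun y => \det (A y))}.
Proof.
move=> /continuous_mxP cA.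
rewrite [X in {for _, continuous X}](_ : _ = fun y =>
  \sum_(s : 'S_p) (-1) ^+ s * \prod_i A y i (s i)) //.
apply: continuous_at_sum => s.
apply: (@continuousM R T (fun=> (-1) ^+ s) (fun y => \prod_i A y i (s i)) x).
  exact: cst_continuous.
exact: continuous_at_prod.
Qed.

Lemma continuous_invmx {p} (A : T -> 'M[R]_p) x : A x \in unitmx ->
  {for x, continuous A} -> {for x, continuous (fun y => invmx (A y))}.
Proof.
move=> uA cA; have cd := continuous_det cA.
have d0 : \det (A x) != 0 by rewrite -unitfE -unitmxE.
(* [invmx] returns a singular matrix unchanged, so the adjugate formula is used only near x, where
   the determinant stays nonzero. *)
have ui : \forall y \near x, (\det (A y))^-1 *: \adj (A y) = invmx (A y).
  have : \forall y \near x, \det (A y) != 0 by exact: (cvgr_neq0 _ cd d0).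
  by apply: filterS => y /=; rewrite -unitfE -unitmxE /invmx => ->.
rewrite /prop_for /continuous_at -(nbhs_singleton ui).
apply: cvg_trans; first by apply: (@near_eq_cvg _ _ (nbhs x)); exact: ui.
move: cA => /continuous_mxP cA.
apply: (@continuousZ _ _ _ (fun y => (\det (A y))^-1) (fun y => \adj (A y)) x).
  exact: continuousV.
apply/continuous_mxP => i j.
rewrite [X in {for _, continuous X}](_ : _ =
  fun y => (-1) ^+ (j + i) * \det (row' j (col' i (A y)))).
  apply: (@continuousM R T (fun=> (-1) ^+ (j + i))
    (fun y => \det (row' j (col' i (A y)))) x); first exact: cst_continuous.
  apply/continuous_det/continuous_mxP => k l.
  rewrite [X in {for _, continuous X}](_ : _ =
    fun y => A y (lift j k) (lift i l)) //.
  by apply/funext => y; rewrite !mxE.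
by apply/funext => y; rewrite mxE.
Qed.

End MatrixContinuity.

Lemma near_eq_continuous {T U : topologicalType} (f g : T -> U) x :
  {near x, f =1 g} -> {for x, continuous f} -> {for x, continuous g}.
Proof.
move=> fg; rewrite /prop_for /continuous_at -(nbhs_singleton fg) => cf.
by apply: cvg_trans cf; apply: (@near_eq_cvg _ _ (nbhs x)).
Qed.

(** * Continuity of covariant derivatives of smooth fields *)

Section SmoothFields.
Context {R : realType} {n : nat}.
Variable U : set 'rV[R]_n.
Hypothesis openU : open U.
Implicit Types (x v w : 'rV[R]_n).

Let nearU x : U x -> \forall y \near x, U y.
Proof. by move=> Ux; exact: open_nbhs_nbhs. Qed.

Lemma smooth_on_differentiable {W : normedModType R} (f : 'rV[R]_n -> W) x :
  smooth_on U f -> U x -> differentiable f x.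
Proof. by move=> /(_ 1%N)[+ _]; exact. Qed.

Lemma smooth_on_derive {W : normedModType R} (f : 'rV[R]_n -> W) v :
  smooth_on U f -> smooth_on U ('D_v f).
Proof. by move=> sf k; have [_] := sf k.+1; exact. Qed.

Lemma smooth_on_twice {W : normedModType R} (f : 'rV[R]_n -> W) x :
  smooth_on U f -> U x -> twice_differentiable f x.
Proof.
move=> sf Ux; split=> [|w].
  by apply: filterS (nearU Ux) => y; exact: smooth_on_differentiable.
by apply: smooth_on_differentiable Ux; exact: smooth_on_derive.
Qed.

Lemma smooth_on_continuous {W : normedModType R} (f : 'rV[R]_n -> W) x :
  smooth_on U f -> U x -> {for x, continuous f}.
Proof. by move=> /(_ 0%N); exact. Qed.

Lemma continuous_form {p} (A : 'rV[R]_n -> 'M[R]_p) (b c : 'rV[R]_n -> 'rV[R]_p)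
    x : {for x, continuous A} -> {for x, continuous b} -> {for x, continuous c} ->
  {for x, continuous (fun y => form (A y) (b y) (c y))}.
Proof.
move=> cA cb cc.
have cT : {for x, continuous (fun y => (c y)^T)}.
  apply/continuous_mxP => i j; rewrite [X in {for _, continuous X}](_ : _ =
    fun y => c y j i); first by move/continuous_mxP: cc.
  by apply/funext => y; rewrite mxE.
by have /continuous_mxP/(_ 0 0) := continuous_mulmx (continuous_mulmx cb cA) cT;
  exact.
Qed.

Variable G : 'rV[R]_n -> 'M[R]_n.
Hypotheses (smoothG : smooth_on U G) (unitG : forall x, U x -> G x \in unitmx).

(** The second argument varies with the point because the covariant derivative of A contains the
    Christoffel term of v and [w *m A y]. *)
Lemma continuous_christoffel v (w : 'rV[R]_n -> 'rV[R]_n) x : U x ->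
  {for x, continuous w} -> {for x, continuous (fun y => christoffel G y v (w y))}.
Proof.
move=> Ux cw.
have cD u : {for x, continuous ('D_u G)}.
  by apply: smooth_on_continuous Ux; exact: smooth_on_derive.
have cc (u : 'rV[R]_n) : {for x, continuous (fun=> u)} by exact: cst_continuous.
(* The direction moves with y, so the derivative is expanded in the fixed basis directions. *)
have cDw : {for x, continuous (fun y => 'D_(w y) G y)}.
  apply: (@near_eq_continuous _ _
    (fun y => \sum_j w y 0 j *: 'D_(delta_mx 0 j) G y)).
    apply: filterS (nearU Ux) => y Uy.
    by rewrite [RHS]derive_row//; exact: smooth_on_differentiable Uy.
  apply: continuous_at_sum => j; apply: continuousZ; last exact: cD.
  by move/continuous_mxP: cw.
apply: continuous_mulmx; last first.
  by apply: continuous_invmx; [exact: unitG|exact: smooth_on_continuous Ux].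
apply/continuous_mxP => i l; rewrite [X in {for _, continuous X}](_ : _ =
  fun y => koszul G y v (w y) (delta_mx 0 l)); last first.
  by apply/funext => y; rewrite mxE.
apply: (@continuousM _ _ (fun=> 2^-1) _ x); first exact: cst_continuous.
apply: (@continuousB _ _ _ (fun y => form ('D_v G y) (w y) (delta_mx 0 l) +
  form ('D_(w y) G y) v (delta_mx 0 l))
  (fun y => form ('D_(delta_mx 0 l) G y) v (w y)) x); last first.
  exact: (continuous_form (cD _) (cc _) cw).
apply: (@continuousD _ _ _ (fun y => form ('D_v G y) (w y) (delta_mx 0 l))
  (fun y => form ('D_(w y) G y) v (delta_mx 0 l)) x).
  exact: (continuous_form (cD _) cw (cc _)).
exact: (continuous_form cDw (cc _) (cc _)).
Qed.

Lemma continuous_nabla_endo A v w x : smooth_on U A -> U x ->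
  {for x, continuous (fun y => nabla_endo G A y v w)}.
Proof.
move=> sA Ux; have cA := smooth_on_continuous sA Ux.
apply: (@near_eq_continuous _ _ (fun y => w *m 'D_v A y +
    christoffel G y v (w *m A y) - christoffel G y v w *m A y)).
  apply: filterS (nearU Ux) => y Uy; rewrite nabla_endoE//.
  exact/diff_derivable/(smooth_on_differentiable sA).
have cc (u : 'rV[R]_n) : {for x, continuous (fun=> u)} by exact: cst_continuous.
have cwA := continuous_mulmx (cc w) cA.
have cDA : {for x, continuous ('D_v A)}.
  by apply: smooth_on_continuous Ux; exact: smooth_on_derive.
have cG1 := @continuous_christoffel v _ x Ux cwA.
have cG2 := @continuous_christoffel v _ x Ux (cc w).
apply: (@continuousB _ _ _ (fun y => w *m 'D_v A y +
  christoffel G y v (w *m A y)) (fun y => christoffel G y v w *m A y) x); last first.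
  exact: (continuous_mulmx cG2 cA).
apply: (@continuousD _ _ _ (fun y => w *m 'D_v A y)
  (fun y => christoffel G y v (w *m A y)) x _ cG1).
exact: (continuous_mulmx (cc w) cDA).
Qed.

(** For an almost complex structure A this trace is its divergence, free of any frame; continuity
    makes the set where it does not vanish open. *)
Lemma continuous_bilin_trace_nabla_endo A x : smooth_on U A -> U x ->
  {for x, continuous (fun y => bilin_trace (invmx (G y)) (nabla_endo G A y))}.
Proof.
move=> sA Ux; apply: continuous_at_sum => a; apply: continuous_at_sum => b.
apply: continuousZ; last exact: continuous_nabla_endo.
have : {for x, continuous (fun y => invmx (G y))}.
  by apply: continuous_invmx; [exact: unitG|exact: smooth_on_continuous Ux].
by move/continuous_mxP.
Qed.

End SmoothFields.

(** In a ball inside U, the mean value theorem on the segment from x to y applies to each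
    component. *)
Lemma jacobian0_locally_constant {R : realType} {n p} (U : set 'rV[R]_n)
    (f : 'rV[R]_n -> 'rV[R]_p) x : open U -> U x ->
  (forall y, U y -> differentiable f y /\ 'J f y = 0) ->
  \forall y \near x, f y = f x.
Proof.
move=> oU Ux df; have /nbhs_ballP[r /= r0 rU] := open_nbhs_nbhs (conj oU Ux).
apply/nbhs_ballP; exists r => //= y; rewrite -ball_normE/= distrC => yr.
have seg s : 0 <= s <= 1 -> U (x + s *: (y - x)).
  move=> /andP[s0 s1]; apply: rU; rewrite -ball_normE/= opprD addrA subrr add0r.
  rewrite normrN normrZ ger0_norm// (le_lt_trans _ yr)//.
  by rewrite -[leRHS]mul1r ler_wpM2r.
apply/rowP => j.
have [s /andP[s0 s1]] := @MVT_line R _ (fun z => f z 0 j) x (y - x) 1 ltr01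
  (fun s sI => differentiable_entry 0 j (df _ (seg s sI)).1).
have sI : 0 <= s <= 1 by rewrite !ltW.
have [dfs Js] := df _ (seg s sI).
have -> : x + 1 *: (y - x) = y by rewrite scale1r addrC subrK.
rewrite mul1r -derive_entry; last exact: diff_derivable.
by rewrite deriveEjacobian// Js mulmx0 mxE => /eqP; rewrite subr_eq0 => /eqP.
Qed.

(** The first coordinate maps W onto a set containing an interval of positive Lebesgue measure,
    whereas countable sets have measure zero. *)
Lemma nbhs_row_uncountable {R : realType} {n} (W : set 'rV[R]_n) (q : 'rV[R]_n) :
  (0 < n)%N -> nbhs q W -> ~ countable W.
Proof.
case: n W q => // n W q _ Wq cW; pose g (t : R) := q + (t - q 0 0) *: delta_mx 0 0.
have cg : {for q 0 0, continuous g}.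
  apply: (@continuousD _ _ _ (fun=> q)); first exact: cst_continuous.
  apply: (@continuousZ _ _ _ (fun t => t - q 0 0) (fun=> delta_mx 0 0)).
    apply: (@continuousB _ _ _ id (fun=> q 0 0)); last exact: cst_continuous.
    exact: cvg_id.
  exact: cst_continuous.
have gq : g (q 0 0) = q by rewrite /g subrr scale0r addr0.
have /nbhs_ballP[r /= r0 rW] : \forall t \near q 0 0, W (g t).
  by apply: cg; rewrite gq.
pose a : R := q 0 0; pose I := [set` `](a - r), (a + r)[%R] : set R.
have cI : countable I.
  apply: (@sub_countable _ _ _ ((fun y : 'rV[R]_n.+1 => y 0 0) @` W)).
    apply: subset_card_le => t tI; exists (g t).
      apply: rW; rewrite -ball_normE/= distrC ltr_distl.
      by move: tI; rewrite /I /a/= in_itv.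
    by rewrite !mxE !eqxx mulr1 addrC subrK.
  exact: sub_countable (card_image_le _ _) cW.
have := countable_lebesgue_measure0 cI.
rewrite lebesgue_measure_itv/= lte_fin.
clear g cg gq rW; have -> : a - r < a + r by lra.
by rewrite -EFinB => /eqP; rewrite eqe; lra.
Qed.

(** * Smooth maps in charts, and their values over an open set of critical values *)

Section Charts.
Context {R : realType} {n p : nat} {M : manifold R n} {N : manifold R p}.
Variable phi : M -> N.
Hypothesis phi_smooth : smooth_map phi.

Lemma open_param_preimage (i : atlas M) (V : set M) : open V ->
  open [set x | img (chart_of i) x /\ V (param (chart_of i) x)].
Proof.
move=> oV; rewrite openE => x [ix Vx].
apply: (@filterI _ (nbhs x)).
  exact: open_nbhs_nbhs (conj (@img_open _ _ _ (chart_of i)) ix).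
exact: (param_continuous ix (open_nbhs_nbhs (conj oV Vx))).
Qed.

Lemma open_local_dom i j : open (local_dom (chart_of i) (chart_of j) phi).
Proof.
apply: (@open_param_preimage i (phi @^-1` dom (chart_of j))).
by apply: open_comp (dom_open _) => z _; exact: phi_smooth.1.
Qed.

Lemma local_expr_img i j x : local_dom (chart_of i) (chart_of j) phi x ->
  img (chart_of j) (local_expr (chart_of i) (chart_of j) phi x).
Proof. by move=> [_ /coord_img]. Qed.

Lemma local_expr_twice i j x : local_dom (chart_of i) (chart_of j) phi x ->
  twice_differentiable (local_expr (chart_of i) (chart_of j) phi) x.
Proof.
exact: (smooth_on_twice (@open_local_dom i j) (phi_smooth.2 i j)).
Qed.

(* Where the differential vanishes identically, phi is locally constant; as M
   is second countable, its values there form a countable set. *)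
Lemma open_image_has_regular_point j (W : set 'rV[R]_p) y :
  (forall q : N, exists p : M, phi p = q) -> (0 < p)%N ->
  open W -> W `<=` img (chart_of j) -> W y ->
  ~ (forall i x, local_dom (chart_of i) (chart_of j) phi x ->
     W (local_expr (chart_of i) (chart_of j) phi x) ->
     'J (local_expr (chart_of i) (chart_of j) phi) x = 0).
Proof.
move=> surj p0 oW Wj Wy crit.
apply: (nbhs_row_uncountable p0 (open_nbhs_nbhs (conj oW Wy))).
have [B cB [_ bB]] := points_second_countable M.
(* [F Q] holds the constant value of phi on Q, read in chart j, if there is one. The point a makes Q
   nonempty, so [F Q] has at most one element. *)
pose F (Q : set M) := [set z | exists2 a, Q a &
  forall b, Q b -> coord (chart_of j) (phi b) = z].
(* By surjectivity z is the value at some a; phi is constant near a, hence on a basic open set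
   around a. *)
have WF : W `<=` \bigcup_(Q in B) F Q.
  move=> z Wz; have [a aE] := surj (param (chart_of j) z).
  have [i ia] := atlas_cover a; set x := coord (chart_of i) a.
  pose f := local_expr (chart_of i) (chart_of j) phi.
  have xa : param (chart_of i) x = a by exact: coordK.
  have fx : f x = z by rewrite /f /local_expr xa aE paramK//; exact: Wj.
  have lx : local_dom (chart_of i) (chart_of j) phi x.
    by split; [exact: coord_img|rewrite xa aE; apply: param_dom; exact: Wj].
  have oU : open (local_dom (chart_of i) (chart_of j) phi `&` f @^-1` W).
    rewrite openE => t [lt Wt].
    apply: (@filterI _ (nbhs t)).
      exact: open_nbhs_nbhs (conj (@open_local_dom i j) lt).
    apply: (smooth_on_continuous (phi_smooth.2 i j) lt).
    exact: open_nbhs_nbhs.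
  have cst : \forall t \near x, f t = f x.
    apply: (jacobian0_locally_constant oU).
      by split=> //=; rewrite fx.
    move=> t [lt Wt]; split; last exact: crit.
    exact: smooth_on_differentiable (phi_smooth.2 i j) lt.
  have nO : \forall b \near a, coord (chart_of j) (phi b) = z.
    have ci : \forall b \near a, f (coord (chart_of i) b) = f x.
      exact: (coord_continuous ia cst).
    have di : \forall b \near a, dom (chart_of i) b.
      exact: (open_nbhs_nbhs (conj (@dom_open _ _ _ (chart_of i)) ia)).
    apply: filterS2 ci di => b fb db; rewrite -fx -fb.
    by rewrite /f /local_expr coordK.
  have [Q [BO Oa] OE] := bB a _ nO.
  by exists Q => //; exists a.
apply: (sub_countable (subset_card_le WF)).
apply: bigcup_countable => // Q _.
have [[z Oz]|F0] := pselect (exists z, F Q z); last first.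
  apply: (@sub_countable _ _ _ (set0 : set 'rV[R]_p)) => //.
  by apply: subset_card_le => z Oz; apply: F0; exists z.
apply: (@sub_countable _ _ _ [set z]) => //; apply: subset_card_le => z' [a Oa az'].
by case: Oz => b Ob bz /=; rewrite -(az' _ Ob) -(bz _ Ob).
Qed.

End Charts.

(** * Metrics, almost complex structures and divergence in a chart *)

Section RiemannianCharts.
Context {R : realType} {n : nat} {M : manifold R n} (g : riemannian_metric M).
Variables (i : atlas M) (x : 'rV[R]_n).
Hypothesis ix : img (chart_of i) x.

Lemma metric_unit : g i x \in unitmx.
Proof. exact/positive_unit/metric_pos. Qed.

Lemma metric_differentiable : differentiable (g i) x.
Proof. exact: smooth_on_differentiable (metric_smooth g i) ix. Qed.

Lemma metric_near_sym : \forall y \near x, (g i y)^T = g i y.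
Proof.
by apply: filterS (open_nbhs_nbhs (conj (@img_open _ _ _ (chart_of i)) ix)) => y; exact: metric_sym.
Qed.

End RiemannianCharts.

Section HermitianCharts.
Context {R : realType} {m : nat} (M : almost_hermitian R m).
Variables (i : atlas M) (x : 'rV[R]_(m + m)).
Hypothesis ix : img (chart_of i) x.

Lemma acs_differentiable : differentiable (acs M i) x.
Proof. exact: smooth_on_differentiable (acs_smooth (acs M) i) ix. Qed.

Lemma acs_isometric_mx : acs M i x *m metric M i x *m (acs M i x)^T = metric M i x.
Proof. exact/isometric_mx/acs_isometric. Qed.

Lemma adapted_frame_at : exists e, adapted_frame (metric M i x) (acs M i x) e.
Proof.
apply: adapted_frame_exists; first exact: metric_sym.
- exact: metric_pos.
- exact: acs_sqr.
- exact: acs_isometric_mx.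
Qed.

(** The vectors e and J e together form an orthonormal basis, so the sum is a trace against the
    inverse metric and depends on the point alone. *)
Lemma divergence_trace e : adapted_frame (metric M i x) (acs M i x) e ->
  divergence (metric M i) (acs M i) x e =
  bilin_trace (invmx (metric M i x)) (nabla_endo (metric M i) (acs M i) x).
Proof.
move=> oe; rewrite -(orthonormal_inv (metric_unit _ ix) oe).
rewrite -bilin_trace_rows; last first.
  by apply: nabla_endo_bilinear;
    [exact: metric_differentiable|exact: acs_differentiable].
rewrite big_split_ord/= -big_split/=; apply: eq_bigr => k _.
by rewrite !rowKu !rowKd row_mul.
Qed.

End HermitianCharts.

(** * Traced identities for holomorphic and horizontally weakly conformal maps *)

Section HermitianMaps.
Context {R : realType} {m n : nat}.
Variables (M : almost_hermitian R m) (N : almost_hermitian R n) (phi : M -> N).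
Hypotheses (phi_smooth : smooth_map phi)
  (phi_hwc : horizontally_weakly_conformal (metric M) (metric N) phi)
  (phi_holomorphic : holomorphic phi).
Variables (i : atlas M) (j : atlas N) (x : 'rV[R]_(m + m)).
Hypothesis lx : local_dom (chart_of i) (chart_of j) phi x.

Let f := local_expr (chart_of i) (chart_of j) phi.
Let D := 'J f x.
Let G := metric M i.
Let H := metric N j.
Let A := acs M i.
Let B := acs N j.

Let ix : img (chart_of i) x. Proof. exact: lx.1. Qed.
Let jfx : img (chart_of j) (f x). Proof. exact: local_expr_img lx. Qed.
Let f2 : twice_differentiable f x. Proof. exact: local_expr_twice. Qed.
Let dG : differentiable G x. Proof. exact: metric_differentiable. Qed.
Let dH : differentiable H (f x). Proof. exact: metric_differentiable. Qed.
Let uG : G x \in unitmx. Proof. exact: metric_unit. Qed.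
Let uH : H (f x) \in unitmx. Proof. exact: metric_unit. Qed.
Let sff := second_fundamental_form H f G x.
Let sff_bilinear : bilinear_map sff.
Proof. exact: second_fundamental_form_bilinear. Qed.

Lemma conformal_factor : exists2 mu, (mu = 0 -> D = 0) &
  D^T *m invmx (G x) *m D = mu *: invmx (H (f x)).
Proof.
apply: conformal_gram => //; first exact: metric_sym.
exact: (phi_hwc lx).
Qed.

(** The left side is a trace against D^T (e^T e) D, where e^T e is the inverse metric of M; by
    hypothesis this is mu times the inverse metric of N, which is e'^T e'. *)
Lemma sum_image_frame {W : lmodType R} (K : 'rV[R]_(n + n) -> 'rV[R]_(n + n) -> W)
    e e' mu : D^T *m invmx (G x) *m D = mu *: invmx (H (f x)) ->
  bilinear_map K -> orthonormal_frame (G x) e -> orthonormal_frame (H (f x)) e' ->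
  \sum_k K (row k e *m D) (row k e *m D) = mu *: \sum_k K (row k e') (row k e').
Proof.
move=> DGD Kb oe oe'.
rewrite [in RHS]bilin_trace_rows// (orthonormal_inv uH oe') -bilin_traceZ -DGD.
rewrite -(orthonormal_inv uG oe) !mulmxA -(mulmxA _ e) -trmx_mul.
rewrite -bilin_trace_rows//.
by apply: eq_bigr => k _; rewrite -!row_mul.
Qed.

Lemma tension_trace e : orthonormal_frame (G x) e ->
  tension H f G x e = bilin_trace (invmx (G x)) sff.
Proof.
by move=> oe; rewrite /tension (bilin_trace_rows e e sff_bilinear)
  (orthonormal_inv uG oe).
Qed.

(** The factor mu is fixed before the frames. The tension has its own frame e0, as [harmonic_map]
    ranges over all orthonormal frames, not just adapted ones. *)
Lemma divergence_tension : exists2 mu, (mu = 0 -> D = 0) &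
  forall e e' e0, adapted_frame (G x) (A x) e ->
    adapted_frame (H (f x)) (B (f x)) e' -> orthonormal_frame (G x) e0 ->
    divergence G A x e *m D =
      mu *: divergence H B (f x) e' + tension H f G x e0 *m B (f x).
Proof.
have [mu mu0 DGD] := conformal_factor; exists mu => // e e' e0 oe oe' oe0.
have dA : differentiable A x by exact: acs_differentiable.
have dB : differentiable B (f x) by exact: acs_differentiable.
have NB : bilinear_map (nabla_endo H B (f x)) by exact: nabla_endo_bilinear.
have NA : bilinear_map (nabla_endo G A x) by exact: nabla_endo_bilinear.
have hol : \forall y \near x, A y *m 'J f y = 'J f y *m B (f y).
  have oL : open (local_dom (chart_of i) (chart_of j) phi).
    exact: open_local_dom.
  by apply: filterS (open_nbhs_nbhs (conj oL lx)) => y; exact: phi_holomorphic.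
rewrite (divergence_trace ix oe) (divergence_trace jfx oe').
rewrite (tension_trace oe0) -(tension_trace oe).
set E := col_mx e (e *m A x) in oe *.
set E' := col_mx e' (e' *m B (f x)) in oe'.
rewrite -(orthonormal_inv uG oe) -(orthonormal_inv uH oe').
rewrite -!bilin_trace_rows//.
rewrite -(sum_image_frame DGD NB oe oe') /tension !mulmx_suml -big_split/=.
(* The terms B(e, J e) add up to the trace of the symmetric B against the antisymmetric matrix
   [invmx (G x) *m A x]. *)
have sffA : \sum_k sff (row k E) (row k E *m A x) = 0.
  rewrite (eq_bigr (fun k => sff (row k E) (row k (E *m A x)))); last first.
    by move=> k _; rewrite row_mul.
  rewrite (bilin_trace_rows _ _ sff_bilinear) mulmxA (orthonormal_inv uG oe).
  apply: bilin_trace_antisymmetric => [|v w].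
    apply: invmx_acs_antisymmetric => //; first exact: metric_sym.
      exact: acs_sqr.
    exact: acs_isometric_mx.
  apply: second_fundamental_form_sym => //; exact: metric_near_sym.
rewrite -[LHS]addr0 -[X in _ + X = _]sffA -big_split/=; apply: eq_bigr => k _.
exact: holomorphic_second_order.
Qed.

(** Tracing [hessian_comp] gives mu times the Laplacian of u plus the derivative of u along the
    tension; the first vanishes because u is harmonic, the second because phi is. *)
Lemma laplacian_comp (V : set N) (u : N -> R) e : open V ->
  harmonic_map (metric M) (metric N) phi -> harmonic_function_on (metric N) V u ->
  V (phi (param (chart_of i) x)) -> orthonormal_frame (G x) e ->
  (forall k, Ck k [set y | local_dom (chart_of i) (chart_of j) phi y /\
     V (phi (param (chart_of i) y))] (u \o phi \o param (chart_of i))) /\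
  \sum_k hessian G (u \o phi \o param (chart_of i)) x (row k e) (row k e) = 0.
Proof.
move=> oV harm hu Vx oe.
pose Y := [set z | img (chart_of j) z /\ V (param (chart_of j) z)].
pose uj z := u (param (chart_of j) z).
pose U := [set y | local_dom (chart_of i) (chart_of j) phi y /\
  V (phi (param (chart_of i) y))].
have [suj huj] : smooth_on Y uj /\ _ := hu j.
have oY : open Y by exact: open_param_preimage.
have oU : open U.
  have -> : U = local_dom (chart_of i) (chart_of j) phi `&`
      [set y | img (chart_of i) y /\ (phi @^-1` V) (param (chart_of i) y)].
    by apply/seteqP; split=> y [] [? ?] // [].
  apply: openI; first exact: open_local_dom.
  apply: open_param_preimage.
  by apply: open_comp oV => z _; exact: phi_smooth.1.
have paramf y : local_dom (chart_of i) (chart_of j) phi y ->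
    param (chart_of j) (f y) = phi (param (chart_of i) y).
  by move=> [_ ?]; rewrite /f /local_expr coordK.
have fY y : U y -> Y (f y).
  by move=> [ly Vy]; split; [exact: local_expr_img|rewrite paramf].
have Ux : U x by [].
have eqU y : U y -> uj (f y) = (u \o phi \o param (chart_of i)) y.
  by move=> [ly _]; rewrite /uj paramf.
split=> [k|].
  apply: (Ck_congr oU eqU); apply: (Ck_comp oU fY (f := f) _ (suj k)).
  by apply: Ck_subset (phi_smooth.2 i j k) => y [].
have -> : \sum_k hessian G (u \o phi \o param (chart_of i)) x (row k e) (row k e)
    = \sum_k hessian G (fun y => uj (f y)) x (row k e) (row k e).
  (* The two expressions of the composite agree on the open set U, so first derivatives are compared
     throughout U before second ones at x. *)
  have De v y : U y -> 'D_v (u \o phi \o param (chart_of i)) y =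
      'D_v (fun y => uj (f y)) y.
    move=> Uy; apply: near_eq_derive.
    by apply: filterS (open_nbhs_nbhs (conj oU Uy)) => z /eqU.
  apply: eq_bigr => k _; rewrite !hessianE.
  have D1 := De (christoffel G x (row k e) (row k e)) x Ux.
  have D2 : 'D_(row k e) ('D_(row k e) (u \o phi \o param (chart_of i))) x =
      'D_(row k e) ('D_(row k e) (fun y => uj (f y))) x.
    apply: near_eq_derive.
    by apply: filterS (open_nbhs_nbhs (conj oU Ux)) => z; exact: De.
  exact: (congr2 (fun a b => a - b) D2 D1).
have u2 : twice_differentiable uj (f x).
  exact: (smooth_on_twice oY suj (fY _ Ux)).
have duj : differentiable uj (f x) by have [/nbhs_singleton] := u2.
rewrite (eq_bigr _ (fun k _ => hessian_comp G H f2 (row k e) (row k e) u2)).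
rewrite big_split/=.
have [mu _ DGD] := conformal_factor.
have [e' oe'] := adapted_frame_at jfx.
have hb : bilinear_map (hessian H uj (f x) : _ -> _ -> R^o).
  exact: hessian_bilinear.
rewrite (sum_image_frame DGD hb oe oe').
rewrite (huj _ (fY _ Ux) _ oe') scaler0 add0r.
have Du0 : 'D_0 uj (f x) = 0 by exact: derive0.
(* Additivity in the direction gathers the remaining terms into one derivative along the tension. *)
have DD : {morph (fun v => 'D_v uj (f x)) : a b / a + b >-> a + b}.
  by move=> a b; exact: deriveDdir.
rewrite -(big_morph _ DD Du0).
by rewrite -/(tension H f G x e) harm.
Qed.

End HermitianMaps.

(** * The implications between the three conditions, and harmonic morphisms *)

Theorem proposition4p4 (R : realType) (m n : nat)
    (M : almost_hermitian R m) (N : almost_hermitian R n) (phi : M -> N)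
    (phi_smooth : smooth_map phi)
    (phi_surjective : forall q : N, exists p : M, phi p = q)
    (phi_hwc : horizontally_weakly_conformal (metric M) (metric N) phi)
    (phi_holomorphic : holomorphic phi) :
  [/\ harmonic_map (metric M) (metric N) phi ->
        J_divergence_vertical phi -> cosymplectic N,
      harmonic_map (metric M) (metric N) phi ->
        cosymplectic N -> J_divergence_vertical phi,
      J_divergence_vertical phi -> cosymplectic N ->
        harmonic_map (metric M) (metric N) phi
    & harmonic_map (metric M) (metric N) phi ->
        harmonic_morphism (metric M) (metric N) phi].
Proof.
(* By holomorphy dphi(J delta J) = J^N dphi(delta J); as J^N is injective, the second condition
   amounts to dphi(delta J) = 0. *)
have Jdiv i j x e : local_dom (chart_of i) (chart_of j) phi x ->
    divergence (metric M i) (acs M i) x e *m acs M i x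
      *m 'J (local_expr (chart_of i) (chart_of j) phi) x =
    divergence (metric M i) (acs M i) x e
      *m 'J (local_expr (chart_of i) (chart_of j) phi) x
      *m acs N j (local_expr (chart_of i) (chart_of j) phi x).
  by move=> /phi_holomorphic hol; rewrite -!mulmxA hol.
have acs_inj j y (v : 'rV[R]_(n + n)) : img (chart_of j) y ->
    v *m acs N j y = 0 -> v = 0.
  move=> jy v0; apply: oppr_inj; rewrite oppr0.
  by rewrite -[v]mulmx1 -mulmxN -(acs_sqr (acs N) jy) mulmxA v0 mul0mx.
split.
- move=> harm vert j y0 jy0 e' oe'; rewrite (divergence_trace jy0 oe').
  apply: contrapT => /eqP div0.
  pose dv y := bilin_trace (invmx (metric N j y))
    (nabla_endo (metric N j) (acs N j) y).
  have cdv y : img (chart_of j) y -> {for y, continuous dv}.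
    move=> jy; apply: (@continuous_bilin_trace_nabla_endo) jy => //.
    + exact: img_open.
    + exact: metric_smooth.
    + by move=> x; exact: metric_unit.
    + exact: acs_smooth.
  pose W := [set y | img (chart_of j) y /\ dv y != 0].
  have oW : open W.
    rewrite openE => y [jy dvy]; apply: (@filterI _ (nbhs y)).
      exact: (open_nbhs_nbhs (conj (@img_open _ _ _ (chart_of j)) jy)).
    exact: (cvgr_neq0 _ (cdv _ jy) dvy).
  (* In dimension 0 the divergence would be zero. *)
  have n0 : (0 < n + n)%N.
    rewrite lt0n; apply: contraNneq div0 => n0; apply/eqP/rowP => k.
    by have := ltn_ord k; rewrite [X in (_ < X)%N]n0.
  apply: (@open_image_has_regular_point _ _ _ _ _ phi phi_smooth j W y0) => //.
    by move=> y [].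
  (* Over W the traced identity reduces to mu (delta J^N) = 0 with delta J^N nonzero, so mu = 0 and
     the differential vanishes. *)
  move=> i x lx [jfx dvx].
  have [mu mu0 E] := divergence_tension phi_smooth phi_hwc phi_holomorphic lx.
  have [e oe] := adapted_frame_at lx.1; have [e1 oe1] := adapted_frame_at jfx.
  have {E} := E e e1 _ oe oe1 oe.
  rewrite (harm _ _ _ lx _ oe) mul0mx addr0 (divergence_trace jfx oe1).
  rewrite (acs_inj j _ _ jfx (etrans (esym (Jdiv _ _ _ _ lx)) (vert _ _ _ lx _ oe))).
  by move/esym/eqP; rewrite scaler_eq0 (negPf dvx) orbF => /eqP/mu0.
- move=> harm cosy i j x lx f e oe; rewrite Jdiv//.
  have jfx := local_expr_img lx.
  have [mu _ E] := divergence_tension phi_smooth phi_hwc phi_holomorphic lx.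
  have [e' oe'] := adapted_frame_at jfx.
  rewrite (E e e' _ oe oe' oe) (cosy _ _ jfx _ oe') (harm _ _ _ lx _ oe).
  by rewrite mul0mx scaler0 addr0 mul0mx.
- move=> vert cosy i j x lx e0 oe0; have jfx := local_expr_img lx.
  have [mu _ E] := divergence_tension phi_smooth phi_hwc phi_holomorphic lx.
  have [e oe] := adapted_frame_at lx.1; have [e' oe'] := adapted_frame_at jfx.
  have := E e e' e0 oe oe' oe0.
  rewrite (acs_inj j _ _ jfx (etrans (esym (Jdiv _ _ _ _ lx)) (vert _ _ _ lx _ oe))).
  by rewrite (cosy _ _ jfx _ oe') scaler0 add0r => /esym/(acs_inj _ _ _ jfx).
- move=> harm; split=> // V u oV hu i; split=> [k|x [ix Vx] e oe].
    (* The image of the domain need not lie in a single chart of N, so a chart is chosen around each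
       image point. *)
    apply: Ck_local => x [ix Vx].
    have [j jx] := atlas_cover (phi (param (chart_of i) x)).
    have lx : local_dom (chart_of i) (chart_of j) phi x by [].
    have [e oe] := adapted_frame_at ix.
    have [/(_ k) C _] := laplacian_comp phi_smooth phi_hwc lx oV harm hu Vx oe.
    by eexists; [|exact: C].
  have [j jx] := atlas_cover (phi (param (chart_of i) x)).
  have lx : local_dom (chart_of i) (chart_of j) phi x by [].
  by have [] := laplacian_comp phi_smooth phi_hwc lx oV harm hu Vx oe.
Qed.
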